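(* Let $k$ be a field of characteristic $2$. For any integer $n>2$, the group algebras $kC_2$, $kC_4$ and $kC_{2^n}$ are pairwise separably inequivalent, i.e. no two of them are separably equivalent.
   Context: $C_r$ denotes the cyclic group of order $r$. Two finite dimensional $k$-algebras $A$ and $B$ are separably equivalent if there are bimodules ${}_AM_B$ and ${}_BN_A$ (with $k$ acting centrally), each finitely generated and projective as a left module and as a right module, together with bimodules ${}_AX_A$, ${}_BY_B$ and bimodule isomorphisms $M\otimes_B N\cong A\oplus X$ and $N\otimes_A M\cong B\oplus Y$. *)

(* Defs.v *)
From HB Require Import structures.
From mathcomp Require Import all_boot all_order all_algebra all_fingroup.
From mathcomp Require Import all_solvable all_field.
From mathcomp Require Import boolp freeg.

Set Implicit Arguments.
Unset Strict Implicit.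
Unset Printing Implicit Defensive.

Import GRing.Theory.

Local Open Scope ring_scope.
Local Open Scope quotient_scope.

(* The group algebra of a finite group: functions gT -> k under convolution.  *)

Definition group_algebra (k : fieldType) (gT : finGroupType) : Type :=
  {ffun gT -> k}.

Section GroupAlgebra.

Variables (k : fieldType) (gT : finGroupType).
Local Notation kG := (group_algebra k gT).

HB.instance Definition _ := Vector.copy kG {ffun gT -> k^o}.

Implicit Types (f g h : kG) (c : k) (x y z : gT).

Definition ga_val f : gT -> k := (f : {ffun gT -> k}).

Definition ga_one : kG := [ffun x => (x == 1%g)%:R].
Definition ga_mul f g : kG :=
  [ffun x => \sum_(y : gT) ga_val f y * ga_val g (y^-1 * x)%g].

Lemma ga_ext f g : ga_val f =1 ga_val g -> f = g.
Proof. by move=> fg; apply/ffunP. Qed.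

Lemma ga_valD f g x : ga_val (f + g) x = ga_val f x + ga_val g x.
Proof. by rewrite /ga_val ffunE. Qed.

Lemma ga_valZ c f x : ga_val (c *: f) x = c * ga_val f x.
Proof. by rewrite /ga_val ffunE. Qed.

Lemma ga_val1 x : ga_val ga_one x = (x == 1%g)%:R.
Proof. by rewrite /ga_val ffunE. Qed.

Lemma ga_valM f g x :
  ga_val (ga_mul f g) x = \sum_(y : gT) ga_val f y * ga_val g (y^-1 * x)%g.
Proof. by rewrite /ga_val ffunE. Qed.

Fact ga_mulA : associative ga_mul.
Proof.
move=> f g h; apply: ga_ext => x; rewrite !ga_valM.
under eq_bigr do rewrite ga_valM mulr_sumr.
under [RHS]eq_bigr do rewrite ga_valM mulr_suml.
rewrite [RHS]exchange_big /=; apply: eq_bigr => y _.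
rewrite (reindex_inj (mulgI y^-1%g)) /=; apply: eq_bigr => z _.
by rewrite invMg invgK mulgA mulgK mulrA.
Qed.

Fact ga_mul1 : left_id ga_one ga_mul.
Proof.
move=> f; apply: ga_ext => x; rewrite ga_valM (bigD1 1%g) //=.
rewrite ga_val1 eqxx mul1r invg1 mul1g big1 ?addr0 // => y /negPf y1.
by rewrite ga_val1 y1 mul0r.
Qed.

Fact ga_mulr1 : right_id ga_one ga_mul.
Proof.
move=> f; apply: ga_ext => x; rewrite ga_valM (bigD1 x) //=.
rewrite ga_val1 mulVg eqxx mulr1 big1 ?addr0 // => y /negPf yx.
by rewrite ga_val1 -eq_mulVg1 yx mulr0.
Qed.

Fact ga_mulDl : left_distributive ga_mul +%R.
Proof.
move=> f g h; apply: ga_ext => x; rewrite ga_valD !ga_valM -big_split /=.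
by apply: eq_bigr => y _; rewrite ga_valD mulrDl.
Qed.

Fact ga_mulDr : right_distributive ga_mul +%R.
Proof.
move=> f g h; apply: ga_ext => x; rewrite ga_valD !ga_valM -big_split /=.
by apply: eq_bigr => y _; rewrite ga_valD mulrDr.
Qed.

Fact ga_one_neq0 : ga_one != 0.
Proof.
apply/eqP => /(congr1 (fun f => ga_val f 1%g)) /eqP.
by rewrite ga_val1 eqxx /ga_val ffunE oner_eq0.
Qed.

HB.instance Definition _ := GRing.Zmodule_isNzRing.Build kG
  ga_mulA ga_mul1 ga_mulr1 ga_mulDl ga_mulDr ga_one_neq0.

Fact ga_scaleAl c f g : c *: (f * g) = (c *: f) * g.
Proof.
apply: ga_ext => x; rewrite ga_valZ !ga_valM mulr_sumr.
by apply: eq_bigr => y _; rewrite ga_valZ mulrA.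
Qed.

Fact ga_scaleAr c f g : c *: (f * g) = f * (c *: g).
Proof.
apply: ga_ext => x; rewrite ga_valZ !ga_valM mulr_sumr.
by apply: eq_bigr => y _; rewrite ga_valZ mulrCA.
Qed.

HB.instance Definition _ := GRing.Lmodule_isLalgebra.Build k kG ga_scaleAl.
HB.instance Definition _ := GRing.Lalgebra_isAlgebra.Build k kG ga_scaleAr.
HB.instance Definition _ := Algebra_isFalgebra.Build k kG.

End GroupAlgebra.

(* Finitely generated projective left modules. *)

Definition fin_gen (R : nzRingType) (P : lmodType R) : Prop :=
  exists n (e : 'I_n -> P), forall p, exists c : 'I_n -> R,
    p = \sum_i c i *: e i.

Definition projective (R : nzRingType) (P : lmodType R) : Prop :=
  forall (U V : lmodType R) (g : {linear U -> V}) (f : {linear P -> V}),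
    (forall v, exists u, g u = v) ->
    exists h : {linear P -> U}, forall p, g (h p) = f p.

(* A-B-bimodules: the left A-module structure is the one of lmodType, and     *)
(* bract m b is the right action m b.  The last axiom is centrality of k.     *)

HB.mixin Record Lmodule_isBimodule (k : fieldType) (A B : falgType k) M
    of GRing.Lmodule A M := {
  bract : M -> B -> M;
  bract1 : forall m, bract m 1 = m;
  bractM : forall m b c, bract m (b * c) = bract (bract m b) c;
  bractDl : forall m m' b, bract (m + m') b = bract m b + bract m' b;
  bractDr : forall m b c, bract m (b + c) = bract m b + bract m c;
  scale_ract : forall (a : A) m b, a *: bract m b = bract (a *: m) b;
  bimod_central : forall (c : k) m, (c%:A : A) *: m = bract m (c%:A : B)
}.

#[short(type="bimodType")]
HB.structure Definition Bimodule (k : fieldType) (A B : falgType k) :=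
  {M of GRing.Lmodule A M & Lmodule_isBimodule k A B M}.

(* M as a right B-module, i.e. as a left module over the converse ring B^c.   *)

Definition right_module (k : fieldType) (A B : falgType k)
  (M : bimodType A B) : Type := M.

Section RightModule.

Variables (k : fieldType) (A B : falgType k) (M : bimodType A B).
Local Notation Mr := (right_module M).

HB.instance Definition _ := GRing.Zmodule.copy Mr M.

Definition right_scale (b : B^c) (m : Mr) : Mr := bract (m : M) (b : B).

Fact right_scaleA (b c : B^c) (m : Mr) :
  right_scale b (right_scale c m) = right_scale (b * c) m.
Proof. by rewrite /right_scale -bractM. Qed.

Fact right_scale1 : left_id 1 right_scale.
Proof. by move=> m; exact: (@bract1 k A B M). Qed.

Fact right_scaleDr : right_distributive right_scale +%R.
Proof. by move=> b m m'; exact: (@bractDl k A B M). Qed.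

Fact right_scaleDl (m : Mr) :
  {morph right_scale^~ m : b c / b + c}.
Proof. by move=> b c; exact: (@bractDr k A B M). Qed.

HB.instance Definition _ := GRing.Zmodule_isLmodule.Build B^c Mr
  right_scaleA right_scale1 right_scaleDr right_scaleDl.

End RightModule.

(* The regular bimodule of A, carried by A^o. *)

Section RegularBimodule.

Variables (k : fieldType) (A : falgType k).

Fact reg_ract1 (m : A^o) : m * (1 : A) = m :> A. Proof. exact: mulr1. Qed.
Fact reg_ractM (m : A^o) (b c : A) : m * (b * c) = m * b * c :> A.
Proof. exact: mulrA. Qed.
Fact reg_ractDl (m m' : A^o) (b : A) : (m + m') * b = m * b + m' * b :> A.
Proof. exact: mulrDl. Qed.
Fact reg_ractDr (m : A^o) (b c : A) : m * (b + c) = m * b + m * c :> A.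
Proof. exact: mulrDr. Qed.
Fact reg_scale_ract (a : A) (m : A^o) (b : A) : a * (m * b) = a * m * b :> A.
Proof. exact: mulrA. Qed.
Fact reg_central (c : k) (m : A^o) : c%:A * m = m * c%:A :> A.
Proof. by rewrite mulr_algl mulr_algr. Qed.

HB.instance Definition _ := Lmodule_isBimodule.Build k A A A^o
  reg_ract1 reg_ractM reg_ractDl reg_ractDr reg_scale_ract reg_central.

End RegularBimodule.

(* Direct sums of bimodules, carried by the product type. *)

Section DirectSum.

Variables (k : fieldType) (A B : falgType k) (M N : bimodType A B).
Local Notation MN := (M * N)%type.
Implicit Types (u v : MN) (a : A) (b c : B).

Definition sum_ract u b : MN := (bract u.1 b, bract u.2 b).

Fact sum_ract1 u : sum_ract u 1 = u.
Proof. by case: u => m n; rewrite /sum_ract !bract1. Qed.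
Fact sum_ractM u b c : sum_ract u (b * c) = sum_ract (sum_ract u b) c.
Proof. by rewrite /sum_ract !bractM. Qed.
Fact sum_ractDl u v b : sum_ract (u + v) b = sum_ract u b + sum_ract v b.
Proof. by rewrite /sum_ract !bractDl. Qed.
Fact sum_ractDr u b c : sum_ract u (b + c) = sum_ract u b + sum_ract u c.
Proof. by rewrite /sum_ract !bractDr. Qed.
Fact sum_scale_ract a u b : a *: sum_ract u b = sum_ract (a *: u) b.
Proof. by rewrite /sum_ract -!scale_ract. Qed.
Fact sum_central (c : k) u : (c%:A : A) *: u = sum_ract u (c%:A : B).
Proof. by rewrite /sum_ract -!bimod_central. Qed.

HB.instance Definition _ := Lmodule_isBimodule.Build k A B MN
  sum_ract1 sum_ractM sum_ractDl sum_ractDr sum_scale_ract sum_central.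

End DirectSum.

(* The tensor product of M and N over B: the quotient of the free abelian     *)
(* group on M * N by the subgroup generated by the biadditivity relations and *)
(* the relations (m b, n) - (m, b n).                                         *)

Section Tensor.

Variables (k : fieldType) (A B C : falgType k).
Variables (M : bimodType A B) (N : bimodType B C).
Local Notation F := {freeg (M * N)%type}.

Definition pure (m : M) (n : N) : F := Freeg [:: (1 : int, (m, n))].

Inductive tensor_rel : F -> Prop :=
| TensorRel0 : tensor_rel 0
| TensorRelB u v : tensor_rel u -> tensor_rel v -> tensor_rel (u - v)
| TensorRelDl m m' n : tensor_rel (pure (m + m') n - pure m n - pure m' n)
| TensorRelDr m n n' : tensor_rel (pure m (n + n') - pure m n - pure m n')
| TensorRelM m b n : tensor_rel (pure (bract m b) n - pure m (b *: n)).

Definition tensor_sub : {pred F} := fun u => `[< tensor_rel u >].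

Fact tensor_sub_closed : zmod_closed tensor_sub.
Proof.
split; first by apply/asboolP; exact: TensorRel0.
by move=> u v /asboolP ru /asboolP rv; apply/asboolP; exact: TensorRelB.
Qed.

HB.instance Definition _ := GRing.isZmodClosed.Build F tensor_sub
  tensor_sub_closed.

Definition tensor : Type := Quotient.quot tensor_sub.

HB.instance Definition _ := GRing.Zmodule.on tensor.

Definition tens (m : M) (n : N) : tensor :=
  \pi_(Quotient.quot tensor_sub) (pure m n).

Local Notation Q := (Quotient.quot tensor_sub).

(* The additive map out of the tensor product induced by f; it sends          *)
(* tens m n to f m n when f is balanced.                                      *)
Definition tens_lift (V : zmodType) (f : M -> N -> V) (t : tensor) : V :=
  fglift (fun mn => f mn.1 mn.2 : zmodule V) (generic_quotient.repr (t : Q)).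

Definition balanced (V : zmodType) (f : M -> N -> V) : Prop :=
  [/\ forall m m' n, f (m + m') n = f m n + f m' n,
      forall m n n', f m (n + n') = f m n + f m n' &
      forall m b n, f (bract m b) n = f m (b *: n)].

Lemma tens_eq (u v : F) : (\pi_Q u == \pi_Q v) = (u - v \in tensor_sub).
Proof. by rewrite Quotient.idealrBE. Qed.

Lemma tensD (u v : F) : (\pi_Q (u + v) : tensor) = \pi_Q u + \pi_Q v.
Proof. exact: Quotient.pi_add. Qed.

Lemma tens_balanced : balanced tens.
Proof.
split=> [m m' n|m n n'|m b n]; rewrite /tens.
- rewrite -tensD; apply/eqP; rewrite tens_eq; apply/asboolP.
  by rewrite opprD addrA; exact: TensorRelDl.
- rewrite -tensD; apply/eqP; rewrite tens_eq; apply/asboolP.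
  by rewrite opprD addrA; exact: TensorRelDr.
- by apply/eqP; rewrite tens_eq; apply/asboolP; exact: TensorRelM.
Qed.

Section Lift.

Variables (V : zmodType) (f : M -> N -> V).
Let lf : F -> V := fglift (fun mn => f mn.1 mn.2 : zmodule V).

Let lfB u v : lf (u - v) = lf u - lf v.
Proof. exact: (@lift_is_additive int _ (zmodule V)). Qed.

Let lf_pure m n : lf (pure m n) = f m n.
Proof. by rewrite /lf /pure liftU scale1r. Qed.

Hypothesis bal_f : balanced f.

Let lf_rel u : tensor_rel u -> lf u = 0.
Proof.
case: bal_f => fDl fDr fM; elim=> {u} [|u v _ u0 _ v0|m m' n|m n n'|m b n].
- by rewrite -[0]subr0 lfB subrr.
- by rewrite lfB u0 v0 subrr.
- by rewrite !lfB !lf_pure fDl -addrA -opprD subrr.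
- by rewrite !lfB !lf_pure fDr -addrA -opprD subrr.
- by rewrite lfB !lf_pure fM subrr.
Qed.

Let tens_lift_pi u : tens_lift f (\pi_Q u) = lf u.
Proof.
rewrite /tens_lift -/lf; apply/eqP; rewrite -subr_eq0 -lfB; apply/eqP/lf_rel.
by apply/asboolP; rewrite -[`[< _ >]]/(_ \in tensor_sub) -tens_eq reprK.
Qed.

Lemma tens_liftE m n : tens_lift f (tens m n) = f m n.
Proof. by rewrite tens_lift_pi lf_pure. Qed.

Lemma tens_liftB : {morph tens_lift f : s t / s - t}.
Proof.
move=> s t; rewrite -[s](reprK (s : Q)) -[t](reprK (t : Q)).
have <- : \pi_Q (generic_quotient.repr (s : Q) - generic_quotient.repr (t : Q)) =
          (\pi_Q (generic_quotient.repr (s : Q)) : tensor) - \pi_Q (generic_quotient.repr (t : Q)) :> tensor.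
  by rewrite Quotient.pi_add Quotient.pi_opp.
by rewrite !tens_lift_pi lfB.
Qed.

End Lift.

Lemma tens_ind (P : tensor -> Prop) :
    (forall m n, P (tens m n)) -> (forall s t, P s -> P t -> P (s - t)) ->
  forall t, P t.
Proof.
move=> Pt PB t; rewrite -[t](reprK (t : Q)).
have P0 : P 0 by rewrite -(subrr (tens 0 0)); exact: PB.
have PN s : P s -> P (- s) by move=> Ps; rewrite -sub0r; exact: PB.
have PD s u : P s -> P u -> P (s + u).
  by move=> Ps Pu; rewrite -[u]opprK; apply/PB/PN.
have pi0 : \pi_Q 0 = 0 :> tensor.
  by apply: (addrI (\pi_Q 0)); rewrite -tensD !addr0.
have PU n x : P (\pi_Q (Freeg [:: (n%:Z, x)])).
  elim: n => [|n IHn]; first by rewrite freegU0 pi0.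
  by rewrite intS -freegUD tensD; apply: PD IHn; case: x => m n'; exact: Pt.
elim/freeg_ind_dom0: (generic_quotient.repr _) => [|z x u _ _ Pu].
  by rewrite pi0.
rewrite tensD; apply: PD Pu; case: z => n //.
by rewrite NegzE -freegUN Quotient.pi_opp; apply/PN/PU.
Qed.

(* a (m (x) n) = (a m) (x) n and (m (x) n) c = m (x) (n c). *)

Definition tens_scale (a : A) : tensor -> tensor :=
  tens_lift (fun m n => tens (a *: m) n).
Definition tens_ract (t : tensor) (c : C) : tensor :=
  tens_lift (fun m n => tens m (bract n c)) t.

Fact tens_scale_balanced a : balanced (fun m n => tens (a *: m) n).
Proof.
case: tens_balanced => tDl tDr tM; split=> * /=; rewrite ?scalerDr ?tDl ?tDr //.
by rewrite scale_ract tM.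
Qed.

Fact tens_ract_balanced c : balanced (fun m n => tens m (bract n c)).
Proof.
case: tens_balanced => tDl tDr tM; split=> * /=; rewrite ?bractDl ?tDl ?tDr //.
by rewrite tM scale_ract.
Qed.

Lemma tens_scaleE a m n : tens_scale a (tens m n) = tens (a *: m) n.
Proof. exact: tens_liftE (tens_scale_balanced a) m n. Qed.
Lemma tens_ractE m n c : tens_ract (tens m n) c = tens m (bract n c).
Proof. exact: tens_liftE (tens_ract_balanced c) m n. Qed.

Lemma tens_scaleB a : {morph tens_scale a : s t / s - t}.
Proof. exact: tens_liftB (tens_scale_balanced a). Qed.
Lemma tens_ractB c : {morph tens_ract^~ c : s t / s - t}.
Proof. exact: tens_liftB (tens_ract_balanced c). Qed.

Let additiveD (h : tensor -> tensor) :
  {morph h : s t / s - t} -> {morph h : s t / s + t}.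
Proof.
move=> hB s t; have h0 : h 0 = 0 by rewrite -{1}[0]subr0 hB subrr.
have hN u : h (- u) = - h u by rewrite -{1}sub0r hB h0 sub0r.
by rewrite -{1}[t]opprK hB hN opprK.
Qed.

Fact tens_scaleA a b t : tens_scale a (tens_scale b t) = tens_scale (a * b) t.
Proof.
elim/tens_ind: t => [m n|s t IHs IHt]; last by rewrite !tens_scaleB IHs IHt.
by rewrite !tens_scaleE scalerA.
Qed.

Fact tens_scale1 : left_id 1 tens_scale.
Proof.
elim/tens_ind=> [m n|s t IHs IHt]; last by rewrite tens_scaleB IHs IHt.
by rewrite tens_scaleE scale1r.
Qed.

Fact tens_scaleDr : right_distributive tens_scale +%R.
Proof. by move=> a; exact: additiveD (tens_scaleB a). Qed.

Fact tens_scaleDl t : {morph tens_scale^~ t : a b / a + b}.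
Proof.
move=> a b; elim/tens_ind: t => [m n|s t IHs IHt].
  by case: tens_balanced => tDl _ _; rewrite !tens_scaleE scalerDl tDl.
by rewrite !tens_scaleB IHs IHt opprD addrACA.
Qed.

HB.instance Definition _ := GRing.Zmodule_isLmodule.Build A tensor
  tens_scaleA tens_scale1 tens_scaleDr tens_scaleDl.

Fact tens_ract1 t : tens_ract t 1 = t.
Proof.
elim/tens_ind: t => [m n|s t IHs IHt]; last by rewrite tens_ractB IHs IHt.
by rewrite tens_ractE bract1.
Qed.

Fact tens_ractM t b c : tens_ract t (b * c) = tens_ract (tens_ract t b) c.
Proof.
elim/tens_ind: t => [m n|s t IHs IHt]; last by rewrite !tens_ractB IHs IHt.
by rewrite !tens_ractE bractM.
Qed.

Fact tens_ractDl s t c : tens_ract (s + t) c = tens_ract s c + tens_ract t c.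
Proof. exact: additiveD (tens_ractB c) s t. Qed.

Fact tens_ractDr t b c : tens_ract t (b + c) = tens_ract t b + tens_ract t c.
Proof.
elim/tens_ind: t => [m n|s t IHs IHt].
  by case: tens_balanced => _ tDr _; rewrite !tens_ractE bractDr tDr.
by rewrite !tens_ractB IHs IHt opprD addrACA.
Qed.

Fact tens_scale_ract (a : A) t c : a *: tens_ract t c = tens_ract (a *: t) c.
Proof.
rewrite -[LHS]/(tens_scale a _) -[a *: t]/(tens_scale a t).
elim/tens_ind: t => [m n|s t IHs IHt].
  by rewrite !(tens_ractE, tens_scaleE).
by rewrite !(tens_ractB, tens_scaleB) IHs IHt.
Qed.

Fact tens_central (c : k) t : (c%:A : A) *: t = tens_ract t (c%:A : C).
Proof.
rewrite -[LHS]/(tens_scale _ t); elim/tens_ind: t => [m n|s t IHs IHt].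
  case: tens_balanced => _ _ tM.
  by rewrite tens_scaleE tens_ractE bimod_central tM bimod_central.
by rewrite tens_ractB tens_scaleB IHs IHt.
Qed.

HB.instance Definition _ := Lmodule_isBimodule.Build k A C tensor
  tens_ract1 tens_ractM tens_ractDl tens_ractDr tens_scale_ract tens_central.

End Tensor.

Definition bimod_iso (k : fieldType) (A B : falgType k)
    (M N : bimodType A B) : Prop :=
  exists f : {linear M -> N},
    bijective f /\ forall m (b : B), f (bract m b) = bract (f m) b.

Definition fg_proj_both (k : fieldType) (A B : falgType k)
    (M : bimodType A B) : Prop :=
  [/\ fin_gen M, projective M,
      fin_gen (right_module M) & projective (right_module M)].

Definition separably_equivalent (k : fieldType) (A B : falgType k) : Prop :=
  exists (M : bimodType A B) (N : bimodType B A)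
         (X : bimodType A A) (Y : bimodType B B),
    [/\ fg_proj_both M, fg_proj_both N,
        bimod_iso (tensor M N) (A^o * X)%type &
        bimod_iso (tensor N M) (B^o * Y)%type].

(* Main.v *)
Require Import Defs.
From HB Require Import structures.
From mathcomp Require Import all_boot all_order all_algebra all_fingroup.
From mathcomp Require Import all_solvable all_field.
From mathcomp Require Import boolp ring zify.

(** In characteristic 2 the group algebra of C_(2^a) is k[x]/x^(2^a), x = g + 1, so
    modules are vector spaces with a nilpotent operator.  Let A be the smaller and
    B the larger of two of the algebras.  From the decomposition of N (x)_A M into
    B and a complement one gets elements n_j of N, m_j of M and a pairing
    N x M -> B such that sum_j <n_j, m_j> = 1 and the tensor sum_j n_j (x) m_j is
    central (retract_data).  Let Z be a B-module.  Then V = Hom_B(N, Z) is an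
    A-module, and an A-endomorphism e of V produces the B-endomorphism

      z |-> sum_j e(n |-> <n, m_j> z)(n_j)

    of Z.  This transfer is additive, maps the identity to the identity, respects
    submodules of Z, and multiplies ranks at most by the number of the n_j, which
    is independent of Z (transferD, transfer1, transfer_comm, transfer_stable,
    rank_transfer).  So a way of breaking endomorphisms of A-modules into simple
    pieces is inherited by B-modules, and for each pair of algebras there is one
    that works over A and fails over B.

    For A = k[x]/x^2 the stable category is semisimple: every endomorphism G of
    an A-module is G g G plus a map factoring through a free module
    (regular_mod_homotopy).  For B = k[y]/y^(2^n) with n > 1 this fails for the
    multiplication by y on k[y]/y^2, because N is projective over B and so the
    maps factoring through sums of copies of N disappear
    (transfer_null_homotopic, order_two_inequivalent).

    For A = k[x]/x^4 one looks at pairs, a module with a submodule.  Over A there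
    are only finitely many indecomposable pairs, and the identity of every pair is
    a sum of endomorphisms of rank at most 6 (low_rank_decomposition).  Over
    k[y]/y^8 there is a pair for each square matrix J, such that endomorphisms of
    the pair induce matrices commuting with J (large_endo).  If J is a large
    nilpotent Jordan block, its centralizer is local and the identity is not a
    sum of matrices of small rank in it (shift_centralizer,
    order_four_inequivalent). *)

Set Implicit Arguments.
Unset Strict Implicit.
Unset Printing Implicit Defensive.

Import GRing.Theory.

Local Open Scope ring_scope.

(** * Linear functionals and Fitting idempotents *)

Section LinearAlgebra.

Variable k : fieldType.

Lemma separating_functional m d (W : 'M[k]_(m, d)) (v : 'rV_d) :
  ~~ (v <= W)%MS -> exists2 a : 'cV_d, W *m a = 0 & v *m a = 1%:M.
Proof.
rewrite submxE => /matrix0Pn[i [j nz]]; rewrite ord1 in nz.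
have colM r (B : 'M_(r, d)) : B *m col j (cokermx W) = col j (B *m cokermx W).
  by rewrite !colE mulmxA.
exists (((v *m cokermx W) 0 j)^-1 *: col j (cokermx W)).
  by rewrite -scalemxAr colM mulmx_coker matrix.col0 scaler0.
rewrite -scalemxAr colM; apply/matrixP=> a b.
by rewrite !ord1 [RHS]mxE [LHS]mxE [X in _ * X]mxE mulVf.
Qed.

(** A functional is prescribed to vanish on the rows of P and to take the values c
    on the rows of Q; only the rows of Q falling into the span of P constrain c. *)
Lemma extend_functional p q d (P : 'M[k]_(p, d)) (Q : 'M[k]_(q, d)) (c : 'cV_q) :
  (forall r (y : 'M_(r, q)), (y *m Q <= P)%MS -> y *m c = 0) ->
  exists2 b : 'cV_d, P *m b = 0 & Q *m b = c.
Proof.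
move=> cons; have [K KP Q'E] : exists2 K : 'M_d, P *m K = 0 &
    forall r (y : 'M_(r, q)), y *m (Q *m K) = 0 -> y *m c = 0.
  exists (cokermx P) => [|r y y0]; first exact: mulmx_coker.
  by apply: cons; rewrite submxE -mulmxA y0.
set Q' := Q *m K in Q'E.
have [L Q'L] : exists L, Q' *m L *m Q' = Q'.
  by exists (pinvmx Q'); rewrite mulmxKpV.
exists (K *m (L *m c)); first by rewrite mulmxA KP mul0mx.
rewrite !mulmxA -/Q'; apply/eqP; rewrite -subr_eq0 -[X in _ - X]mul1mx -mulmxBl.
by apply/eqP/Q'E; rewrite mulmxBl Q'L mul1mx subrr.
Qed.

(** Fitting: if p has a nonzero fixed vector, the projection onto the part where p
    is invertible is a polynomial in p, without constant term so that its rank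
    does not exceed that of p. *)
Lemma fitting_idempotent d (p : 'M[k]_d.+1) (v : 'rV_d.+1) :
    v != 0 -> v *m p = v ->
  exists q : {poly k}, let f := horner_mx p (q * 'X) in
    f *m f = f /\ v *m f = v.
Proof.
move=> v0 vp; have [a [nu] nu0 def] : exists a, exists2 nu,
    ~~ root nu 0 & mxminpoly p = nu * 'X^a.
  have [a [nu /implyP nu0 def]] := multiplicity_XsubC (mxminpoly p) 0.
  have m0 : mxminpoly p != 0 by rewrite monic_neq0 // mxminpoly_monic.
  exists a, nu; first by apply: nu0.
  by rewrite def subr0.
(* One extra factor 'X keeps the constant term zero even when a = 0. *)
have cop : coprimep ('X^(a.+1)) nu.
  by rewrite coprimep_expl // coprimep_sym coprimepX.
have [[u w] /= uw1] := Bezout_eq1_coprimepP _ _ cop.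
have vh (r : {poly k}) : v *m horner_mx p r = r.[1] *: v.
  elim/poly_ind: r => [|r c IH]; first by rewrite rmorph0 mulmx0 horner0 scale0r.
  rewrite rmorphD rmorphM /= horner_mx_X horner_mx_C hornerMXaddC mulr1.
  by rewrite mulmxDr mulmxA IH -scalemxAl vp mul_mx_scalar scalerDl.
have nu1 : nu.[1] = 0.
  have : mxminpoly p %| mxminpoly p by [].
  rewrite dvd_mxminpoly => /eqP mp; have := vh (mxminpoly p).
  rewrite mp mulmx0 => /esym/eqP; rewrite scaler_eq0 (negPf v0) orbF def.
  by rewrite hornerM hornerXn expr1n mulr1 => /eqP.
exists (u * 'X^a); rewrite -mulrA -exprSr /=; split; last first.
  rewrite vh -[X in X.[1]](addrK (w * nu)) uw1 !hornerE nu1 mulr0 subr0.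
  by rewrite scale1r.
set f := horner_mx _ _; have -> : f *m f = f * f by [].
have e1 : f * (1 - f) = 0.
  have -> : 1 - f = horner_mx p (w * nu).
    by rewrite /f -(rmorph1 (horner_mx p)) -rmorphB /= -uw1 addrC addKr.
  rewrite /f -rmorphM /=; apply/eqP; rewrite -dvd_mxminpoly def.
  by apply/dvdpP; exists (u * 'X * w); rewrite exprS; ring.
by apply/eqP; rewrite eq_sym -subr_eq0 -{1}[f]mulr1 -mulrBr e1.
Qed.

End LinearAlgebra.

(** * Submodules of modules over k[X]/X^4 *)

Section CyclicMaps.

Variables (k : fieldType) (d : nat) (X : 'M[k]_d.+1).

(** For s killed by X^n and a functional al killing the image of X^n, this is the
    composite of the maps V -> k[X]/X^n given by al and k[X]/X^n -> V given by s. *)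
Definition cyclic_map n (al : 'cV_d.+1) (s : 'rV_d.+1) : 'M[k]_d.+1 :=
  \sum_(i < n) X ^+ (n.-1 - i) *m al *m (s *m X ^+ i).

Let X0 : X ^+ 0 = 1%:M. Proof. by []. Qed.
Let XS i : X *m X ^+ i = X ^+ i.+1. Proof. by rewrite exprS. Qed.
Let XSr i : X ^+ i *m X = X ^+ i.+1. Proof. by rewrite exprSr. Qed.
Let XD i j : X ^+ i *m X ^+ j = X ^+ (i + j). Proof. by rewrite exprD. Qed.

Lemma cyclic_map_comm n al s :
  X ^+ n *m al = 0 -> s *m X ^+ n = 0 ->
  X *m cyclic_map n al s = cyclic_map n al s *m X.
Proof.
case: n => [|n] Xal sX; first by rewrite /cyclic_map big_ord0 mulmx0 mul0mx.
rewrite /cyclic_map mulmx_sumr mulmx_suml big_ord_recl [RHS]big_ord_recr /=.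
rewrite subn0 !mulmxA XS Xal !mul0mx add0r.
rewrite -[X in _ = _ + X]mulmxA XSr -[X in _ = _ + X]mulmxA sX mulmx0 addr0.
apply: eq_bigr => i _; rewrite !mulmxA XS -[RHS]mulmxA XSr /bump add1n.
by rewrite -subSn ?subSS // mulmxA.
Qed.

Lemma rank_cyclic_map n al s : (\rank (cyclic_map n al s) <= n)%N.
Proof.
rewrite /cyclic_map -[X in (_ <= X)%N]card_ord -sum1_card.
elim/big_rec2: _ => [|i x y _ IH]; first by rewrite mxrank0.
apply: leq_trans (mxrank_add _ _) (leq_add _ IH).
exact: leq_trans (mxrankM_maxl _ _) (rank_leq_col _).
Qed.

(** Normalizing al on the socle of the cyclic module generated by s makes this
    socle pointwise fixed, which shows that the map is not nilpotent. *)
Lemma socle_cyclic_map n al s : s *m X ^+ n = 0 -> s *m X ^+ n.-1 *m al = 1%:M ->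
  s *m X ^+ n.-1 *m cyclic_map n al s = s *m X ^+ n.-1.
Proof.
case: n => [|n] sX sal; last first.
  rewrite /cyclic_map mulmx_sumr big_ord_recr /= subnn X0 mul1mx mulmxA sal.
  rewrite mul1mx big1 ?add0r // => i _.
  rewrite !mulmxA -[s *m _ *m _]mulmxA XD.
  have -> : (n + (n - i) = n.+1 + (n - i).-1)%N by have := ltn_ord i; lia.
  by rewrite -XD mulmxA sX !mul0mx.
by rewrite sX !mul0mx.
Qed.

Lemma socle_cyclic_map_small n m (s : 'rV_d.+1) (be : 'cV_d.+1) t : (m < n)%N ->
  s *m X ^+ n = 0 -> X ^+ m *m be = 0 ->
  s *m X ^+ n.-1 *m cyclic_map m be t = 0.
Proof.
move=> mn sX Xbe; rewrite /cyclic_map mulmx_sumr big1 // => i _.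
rewrite !mulmxA -[s *m _ *m _]mulmxA XD.
have -> : (n.-1 + (m.-1 - i) = (n.-1 - i).-1 + m)%N by have := ltn_ord i; lia.
by rewrite -XD mulmxA -[_ *m X ^+ m *m be]mulmxA Xbe mulmx0 !mul0mx.
Qed.

Lemma cyclic_mapS n al s :
  cyclic_map n.+1 al s = cyclic_map n (X *m al) s + al *m (s *m X ^+ n).
Proof.
rewrite /cyclic_map big_ord_recr /= subnn X0 mul1mx; congr (_ + _).
apply: eq_bigr => i _; rewrite [X in _ = X *m _]mulmxA XSr.
by congr (X ^+ _ *m _ *m _); have := ltn_ord i; lia.
Qed.

Lemma cyclic_map0 al s : cyclic_map 0 al s = 0.
Proof. exact: big_ord0. Qed.

End CyclicMaps.

(** A pair is a k[X]-module V = k^(d+1) with X^4 = 0 and a submodule U (the row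
    space of the matrix U).  Assume that no endomorphism of rank at most 6 of the
    pair has a nonzero fixed vector; the aim is V = 0.  Every lemma named no_pair
    or no_picket excludes one type of indecomposable summand: if the summand
    were there, composing a map from it with a map to it would give such an
    endomorphism, so a certain subspace condition must fail.  The conditions taken
    together then force X^3, X^2, X and finally V to vanish. *)
Section SubmodulePairs.

Variables (k : fieldType) (d u : nat) (X : 'M[k]_d.+1) (U : 'M[k]_(u, d.+1)).
Hypothesis stabU : stablemx U X.
Hypothesis no_endo : forall (p : 'M[k]_d.+1) (v : 'rV_d.+1),
  X *m p = p *m X -> stablemx U p -> (\rank p <= 6)%N -> v *m p = v -> v = 0.

Let X0 : X ^+ 0 = 1%:M. Proof. by []. Qed.
Let X1 : X ^+ 1 = X. Proof. by []. Qed.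
Let XS i : X *m X ^+ i = X ^+ i.+1. Proof. by rewrite exprS. Qed.
Let XSr i : X ^+ i *m X = X ^+ i.+1. Proof. by rewrite exprSr. Qed.
Let XD i j : X ^+ i *m X ^+ j = X ^+ (i + j). Proof. by rewrite exprD. Qed.

Lemma stable_expr i : stablemx U (X ^+ i).
Proof.
elim: i => [|i IH]; first by rewrite X0 mulmx1.
by rewrite -XSr; apply: stablemxM.
Qed.

(** The pair V = k[X]/X^n with U = (X^(n-l)). *)
Lemma no_picket n l (s : 'rV_d.+1) :
    (l <= n <= 6)%N -> s *m X ^+ n = 0 -> (s *m X ^+ (n - l) <= U)%MS ->
  (s *m X ^+ n.-1 <= X ^+ n + U *m X ^+ l)%MS.
Proof.
move=> /andP[ln n6] sX sU; rewrite addsmxE.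
case: (boolP (_ <= _)%MS) => // /separating_functional[al].
rewrite mul_col_mx => /eqP; rewrite col_mx_eq0 => /andP[/eqP Xal /eqP Ual] sal.
suff s0 : s *m X ^+ n.-1 = 0.
  by move/matrixP/(_ 0 0)/eqP: sal; rewrite s0 mul0mx !mxE eq_sym oner_eq0.
apply: (no_endo (p := cyclic_map X n al s)).
- exact: cyclic_map_comm.
- rewrite mulmx_sumr; apply: summx_sub => i _; have [li|il] := leqP l (n.-1 - i).
    rewrite !mulmxA -(subnK li) -XD mulmxA.
    have /submxP[D ->] := stable_expr (n.-1 - i - l).
    by rewrite -!mulmxA [U *m _]mulmxA [_ *m (al *m _)]mulmxA Ual !(mul0mx, mulmx0) sub0mx.
  rewrite mulmxA; apply: mulmx_sub.
  have -> : (i = (n - l) + (i - (n - l)) :> nat)%N by have := ltn_ord i; lia.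
  rewrite -XD mulmxA; apply: submx_trans (submxMr _ sU) (stable_expr _).
- exact: leq_trans (rank_cyclic_map _ _ _ _) n6.
- exact: socle_cyclic_map.
Qed.

(** The remaining indecomposable pairs have V = k[X]/X^n + k[X]/X^m with m < n, and
    the endomorphism is a sum of two cyclic maps; the first one alone determines
    the action on the socle of the summand generated by s. *)
Lemma no_two_generated_pair n m (s t : 'rV_d.+1) (al be : 'cV_d.+1) :
    (m < n)%N -> (n + m <= 6)%N ->
    s *m X ^+ n = 0 -> t *m X ^+ m = 0 -> X ^+ n *m al = 0 -> X ^+ m *m be = 0 ->
    stablemx U (cyclic_map X n al s + cyclic_map X m be t) ->
  s *m X ^+ n.-1 *m al != 1%:M.
Proof.
move=> mn nm sX tX Xal Xbe stab; apply/eqP => sal.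
suff s0 : s *m X ^+ n.-1 = 0.
  by move/matrixP/(_ 0 0)/eqP: sal; rewrite s0 mul0mx !mxE eq_sym oner_eq0.
apply: (no_endo (p := cyclic_map X n al s + cyclic_map X m be t)) => //.
- by rewrite mulmxDr mulmxDl !cyclic_map_comm.
- by apply: leq_trans (mxrank_add _ _) (leq_trans _ nm);
     rewrite leq_add ?rank_cyclic_map.
- by rewrite mulmxDr socle_cyclic_map // (socle_cyclic_map_small _ mn sX Xbe) addr0.
Qed.



Let capK r r' r2 (V : 'M[k]_(r', d.+1)) (C : 'M[k]_(r, d.+1))
    (P : 'M[k]_(r2, d.+1)) (Q : 'M[k]_d.+1) (al : 'cV_d.+1) :
  (V :&: P)%MS *m Q *m al = 0 -> (C <= V)%MS -> (C <= P)%MS ->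
  C *m Q *m al = 0.
Proof.
move=> Wal CU CP; have /submxP[D ->] : (C <= V :&: P)%MS by rewrite sub_capmx CU.
by rewrite -!mulmxA [X in D *m X]mulmxA Wal mulmx0.
Qed.

Let stab i : (U *m X ^+ i <= U)%MS. Proof. exact: stable_expr. Qed.

Let sub_pow r (C : 'M_(r, d.+1)) i : (i > 0)%N -> (C *m X ^+ i <= X)%MS.
Proof. by case: i => // i _; rewrite -XSr mulmxA submxMl. Qed.


(** V = k[X]/X^(n+2) + k[X]/X, with generators s and t, and U generated by
    X^n s + t.  The functional be for t is forced on U: the image of a vector of U
    lies in U as soon as its t-coordinate matches its X^n s-coordinate.  The
    other lemmas of this group choose be in the same way. *)
Lemma no_pair_n_1_order2 n (s w : 'rV_d.+1) :
    (n <= 2)%N -> X ^+ n.+2 = 0 -> (w <= U)%MS -> s *m X ^+ n.+1 = w *m X ->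
  (s *m X ^+ n.+1 <= (U :&: X) *m X)%MS.
Proof.
move=> n2 Xn wU sw.
case: (boolP (_ <= _)%MS) => // /separating_functional[al Wal sal].
have [be Xbe Ube] : exists2 be : 'cV_d.+1, X *m be = 0 & U *m be = U *m X *m al.
  apply: extend_functional => r y yX; rewrite !mulmxA.
  by apply: capK Wal _ _; rewrite ?submxMl.
have Uj j : U *m X ^+ j.+2 *m al = 0.
  by rewrite -XSr mulmxA; apply: capK Wal _ _; rewrite ?stab ?sub_pow.
exfalso; suff: s *m X ^+ n.+1 *m al != 1%:M by rewrite sal eqxx.
apply: (no_two_generated_pair (n := n.+2) (m := 1) (t := w - s *m X ^+ n) (be := be)).
- by [].
- by lia.
- by rewrite Xn mulmx0.
- by rewrite mulmxBl -mulmxA XSr sw subrr.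
- by rewrite Xn mul0mx.
- by [].
suff -> : U *m (cyclic_map X n.+2 al s + cyclic_map X 1 be (w - s *m X ^+ n)) =
          U *m X *m al *m w + U *m al *m (w *m X).
  by rewrite addmx_sub // mulmx_sub // (submx_trans (submxMr _ wU)).
rewrite !cyclic_mapS !cyclic_map0 sw X0 mulmx1 add0r.
rewrite mulmxDr [U *m (be *m _)]mulmxA Ube mulmxBr !mulmxDr.
have -> : U *m cyclic_map X n (X *m (X *m al)) s = 0.
  rewrite /cyclic_map mulmx_sumr big1 // => i _; rewrite !mulmxA -[U *m _ *m X]mulmxA.
  by rewrite XSr -[U *m _ *m X]mulmxA XSr Uj !mul0mx.
by rewrite add0r !mulmxA addrCA addrAC subrr add0r.
Qed.

Let mulX2 m1 (C : 'M_(m1, d.+1)) : C *m X *m X = C *m X ^+ 2.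
Proof. by rewrite -mulmxA. Qed.
Let mulXS m1 (C : 'M_(m1, d.+1)) i : C *m X ^+ i *m X = C *m X ^+ i.+1.
Proof. by rewrite -mulmxA XSr. Qed.

Let mul_cyclic4 al s : U *m cyclic_map X 4 al s =
  U *m X ^+ 3 *m al *m s + U *m X ^+ 2 *m al *m (s *m X) +
  U *m X *m al *m (s *m X ^+ 2) + U *m al *m (s *m X ^+ 3).
Proof.
rewrite !cyclic_mapS cyclic_map0 add0r X0 X1 mulmx1 !mulmxDr !mulmxA.
by rewrite !(mulX2 U) mulXS.
Qed.

Let mul_cyclic2 be t : U *m cyclic_map X 2 be t =
  U *m X *m be *m t + U *m be *m (t *m X).
Proof.
by rewrite !cyclic_mapS cyclic_map0 add0r X0 X1 mulmx1 !mulmxDr !mulmxA.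
Qed.

Let mul_cyclic1 be t : U *m cyclic_map X 1 be t = U *m be *m t.
Proof. by rewrite !cyclic_mapS cyclic_map0 add0r X0 mulmx1 mulmxA. Qed.

Let Umap (w : 'rV_d.+1) (c : 'M[k]_(u, 1)) : (w <= U)%MS -> (c *m w <= U)%MS.
Proof. exact: mulmx_sub. Qed.
Let UmapX (w : 'rV_d.+1) i : (w <= U)%MS -> (w *m X ^+ i <= U)%MS.
Proof. by move=> wU; apply: submx_trans (submxMr _ wU) (stab i). Qed.

Hypothesis X4 : X ^+ 4 = 0.

(** V = k[X]/X^4 + k[X]/X^2 and U generated by X^2 s + X t. *)
Lemma no_pair_4_2_order2 (s w a : 'rV_d.+1) :
    (w <= U)%MS -> w = a *m X -> s *m X ^+ 3 = w *m X ->
  (s *m X ^+ 3 <= U *m X ^+ 2 + (U :&: X ^+ 2) *m X)%MS.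
Proof.
move=> wU wa sw; rewrite addsmxE.
case: (boolP (_ <= _)%MS) => // /separating_functional[al].
rewrite mul_col_mx => /eqP; rewrite col_mx_eq0 => /andP[/eqP c2 /eqP Wal] sal.
have [be Xbe Ube] : exists2 be : 'cV_d.+1, X ^+ 2 *m be = 0 & U *m be = U *m X *m al.
  apply: extend_functional => r y yX; rewrite !mulmxA.
  by apply: capK Wal _ _; rewrite ?submxMl.
have c3 : U *m X ^+ 3 *m al = 0.
  have /submxP[D UX] := stab 1.
  by rewrite -XS mulmxA -X1 UX -mulmxA -mulmxA [U *m _]mulmxA c2 mulmx0.
have b1 : U *m X *m be = 0.
  have /submxP[D UX] := stab 1; rewrite -X1 UX -mulmxA Ube !mulmxA -UX X1.
  by rewrite mulX2.
exfalso; suff: s *m X ^+ 3 *m al != 1%:M by rewrite sal eqxx.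
pose t := a - s *m X.
have tE : w = s *m X ^+ 2 + t *m X by rewrite mulmxBl mulX2 -wa addrC subrK.
apply: (no_two_generated_pair (n := 4) (m := 2) (t := t) (be := be)) => //.
- by rewrite X4 mulmx0.
- by rewrite mulmxBl -mulmxA XS sw wa mulX2 subrr.
- by rewrite X4 mul0mx.
rewrite mulmxDr mul_cyclic4 mul_cyclic2 b1 c2 c3 Ube !mul0mx !add0r.
rewrite addrAC -mulmxDr -tE sw addmx_sub ?Umap //.
exact: (UmapX 1).
Qed.

(** V = k[X]/X^4 + k[X]/X^2 and U generated by X s + t. *)
Lemma no_pair_4_2_order3 (s w : 'rV_d.+1) :
    (w <= U)%MS -> s *m X ^+ 3 = w *m X ^+ 2 ->
  (s *m X ^+ 3 <= (U :&: X ^+ 2) *m X)%MS.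
Proof.
move=> wU sw.
case: (boolP (_ <= _)%MS) => // /separating_functional[al Wal sal].
have [be Xbe Ube] : exists2 be : 'cV_d.+1, X ^+ 2 *m be = 0 & U *m be = U *m X *m al.
  apply: extend_functional => r y yX; rewrite !mulmxA.
  by apply: capK Wal _ _; rewrite ?submxMl.
have c3 : U *m X ^+ 3 *m al = 0.
  by rewrite -XSr mulmxA; apply: capK Wal _ _; rewrite ?stab ?submxMl.
have b1 : U *m X *m be = U *m X ^+ 2 *m al.
  have /submxP[D UX] := stab 1; rewrite -X1 UX -mulmxA Ube !mulmxA -UX X1.
  by rewrite mulX2.
exfalso; suff: s *m X ^+ 3 *m al != 1%:M by rewrite sal eqxx.
pose t := w - s *m X.
have tE : w = s *m X + t by rewrite addrC subrK.
apply: (no_two_generated_pair (n := 4) (m := 2) (t := t) (be := be)) => //.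
- by rewrite X4 mulmx0.
- by rewrite mulmxBl -mulmxA XS sw subrr.
- by rewrite X4 mul0mx.
rewrite mulmxDr mul_cyclic4 mul_cyclic2 b1 c3 Ube mul0mx add0r addrAC addrACA.
have tE2 : w *m X = s *m X ^+ 2 + t *m X by rewrite {1}tE mulmxDl mulX2.
rewrite -!mulmxDr -tE -tE2 sw !addmx_sub ?Umap ?UmapX //.
exact: (UmapX 1).
Qed.

(** V = k[X]/X^4 + k[X]/X^2 and U generated by X s + t and X^2 s. *)
Lemma no_pair_4_2_two_generators (s w : 'rV_d.+1) :
    (w <= U)%MS -> (s *m X ^+ 2 <= U)%MS -> s *m X ^+ 3 = w *m X ^+ 2 ->
  (s *m X ^+ 3 <= (U *m X :&: X ^+ 2) *m X)%MS.
Proof.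
move=> wU sU sw.
case: (boolP (_ <= _)%MS) => // /separating_functional[al Wal sal].
have [be Xbe Ube] : exists2 be : 'cV_d.+1, X ^+ 2 *m be = 0 &
    U *m X *m be = U *m X ^+ 2 *m al.
  apply: extend_functional => r y yX; rewrite -XSr !mulmxA -[y *m U *m X]mulmxA.
  by apply: capK Wal _ _; rewrite ?submxMl.
have c3 : U *m X ^+ 3 *m al = 0.
  rewrite -XSr mulmxA; apply: capK Wal _ _; last exact: submxMl.
  by rewrite -XSr mulmxA submxMr // stabU.
exfalso; suff: s *m X ^+ 3 *m al != 1%:M by rewrite sal eqxx.
pose t := w - s *m X.
have tE : w = s *m X + t by rewrite addrC subrK.
apply: (no_two_generated_pair (n := 4) (m := 2) (t := t) (be := be)) => //.
- by rewrite X4 mulmx0.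
- by rewrite mulmxBl -mulmxA XS sw subrr.
- by rewrite X4 mul0mx.
rewrite mulmxDr mul_cyclic4 mul_cyclic2 Ube c3 mul0mx add0r.
rewrite -[_ + _ *m (s *m X ^+ 3)]addrA addrACA -mulmxDr -tE sw.
have tU : (t *m X <= U)%MS.
  by rewrite mulmxBl mulX2 addmx_sub ?eqmx_opp // (UmapX 1).
rewrite !addmx_sub ?Umap //; exact: UmapX.
Qed.

(** V = k[X]/X^4 + k[X]/X and U generated by X s + t. *)
Lemma no_pair_4_1_order3 (s w : 'rV_d.+1) :
    (w <= U)%MS -> s *m X ^+ 2 = w *m X ->
  (s *m X ^+ 3 <= (U :&: X) *m X ^+ 2)%MS.
Proof.
move=> wU sw.
case: (boolP (_ <= _)%MS) => // /separating_functional[al Wal sal].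
have [be Xbe Ube] : exists2 be : 'cV_d.+1, X *m be = 0 & U *m be = U *m X ^+ 2 *m al.
  apply: extend_functional => r y yX; rewrite 2!mulmxA.
  by apply: capK Wal _ _; rewrite ?submxMl.
have c3 : U *m X ^+ 3 *m al = 0.
  by rewrite -XS mulmxA; apply: capK Wal _ _; rewrite ?stabU ?submxMl.
exfalso; suff: s *m X ^+ 3 *m al != 1%:M by rewrite sal eqxx.
pose t := w - s *m X.
have tE : w = s *m X + t by rewrite addrC subrK.
apply: (no_two_generated_pair (n := 4) (m := 1) (t := t) (be := be)) => //.
- by rewrite X4 mulmx0.
- by rewrite mulmxBl mulX2 sw subrr.
- by rewrite X4 mul0mx.
rewrite mulmxDr mul_cyclic4 mul_cyclic1 Ube c3 mul0mx add0r.
rewrite -[_ + _ *m (s *m X ^+ 3)]addrA addrAC -mulmxDr -tE.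
have sX2 : (s *m X ^+ 2 <= U)%MS by rewrite sw (UmapX 1).
have sX3 : (s *m X ^+ 3 <= U)%MS by rewrite -mulXS (UmapX 1).
by rewrite !addmx_sub ?Umap.
Qed.

Lemma zero_of_rows m1 (C : 'M[k]_(m1, d.+1)) (P : 'M_d.+1) :
  (forall w : 'rV_d.+1, (w <= C)%MS -> w *m P = 0) -> C *m P = 0.
Proof. by move=> CP; apply/row_matrixP => i; rewrite row_mul CP ?row0 ?row_sub. Qed.

Lemma submx_powP (w : 'rV_d.+1) m1 (C : 'M[k]_(m1, d.+1)) (P : 'M_d.+1) :
  (w <= C *m P)%MS -> exists2 w' : 'rV_d.+1, (w' <= C)%MS & w = w' *m P.
Proof.
by move=> /submxP[D ->]; exists (D *m C); rewrite ?submxMl ?mulmxA.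
Qed.

(** A vector s X^3 is pushed through smaller and smaller subspaces: into U, then
    U X, (U cap VX) X, U X^2, (U cap VX^2) X, (UX cap VX^2) X, and finally
    (U cap VX) X^2, which is zero. *)
Lemma cube_zero : X ^+ 3 = 0.
Proof.
have pick l (s : 'rV_d.+1) : (l <= 4)%N -> (s *m X ^+ (4 - l) <= U)%MS ->
    (s *m X ^+ 3 <= U *m X ^+ l)%MS.
  move=> l4 sU; have := @no_picket 4 l s; rewrite X4 adds0mx; apply => //.
    by rewrite l4.
  by rewrite mulmx0.
have UX3 : U *m X ^+ 3 = 0.
  apply: zero_of_rows => w wU.
  by have := pick 4 w isT; rewrite X4 X0 mulmx0 mulmx1 => /(_ wU)/submx0null.
rewrite -[X ^+ 3]mul1mx; apply: zero_of_rows => s _.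
have sU : (s *m X ^+ 3 <= U)%MS.
  have := pick 0 s isT; rewrite X0 mulmx1; apply.
  by rewrite X4 mulmx0 sub0mx.
have /submx_powP[w wU sw] := pick 1 s isT sU.
rewrite X1 in sw.
have /submx_powP[w'] := no_pair_n_1_order2 (n := 2) isT X4 wU sw.
rewrite sub_capmx => /andP[w'U /submxP[a w'a]] sw'.
have := no_pair_4_2_order2 w'U w'a sw'.
case/sub_addsmxP => -[D1 D2] /= sE.
have /submxP[c0 cX] : (D2 *m (U :&: X ^+ 2) <= X ^+ 2)%MS.
  by rewrite mulmx_sub ?capmxSr.
have cU : (c0 *m X ^+ 2 <= U)%MS by rewrite -cX mulmx_sub ?capmxSl.
have {sE} sX2 : (s *m X ^+ 3 <= U *m X ^+ 2)%MS.
  by rewrite sE addmx_sub ?submxMl // mulmxA cX mulXS pick.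
have /submx_powP[w2 w2U sw2] := sX2.
have /submx_powP[w3] := no_pair_4_2_order3 w2U sw2.
rewrite sub_capmx => /andP[w3U /submxP[c w3c]]; rewrite w3c mulXS in w3U * => sc.
have /submx_powP[g] := no_pair_4_2_two_generators w2U w3U (etrans (esym sc) sw2).
rewrite sub_capmx => /andP[/submx_powP[e eU ge] /submxP[a' ga]].
rewrite {1}ga mulXS => ca.
have /submx_powP[f] := no_pair_4_1_order3 eU (etrans (esym ga) ge).
rewrite sub_capmx => /andP[fU /submxP[h fh]].
rewrite fh -mulmxA XS => ah; rewrite sc ca ah.
by have := pick 3 h isT; rewrite X1 -fh UX3 => /(_ fU)/submx0null.
Qed.

Lemma square_zero : X ^+ 2 = 0.
Proof.
have X3 := cube_zero.
have pick l (s : 'rV_d.+1) : (l <= 3)%N -> (s *m X ^+ (3 - l) <= U)%MS ->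
    (s *m X ^+ 2 <= U *m X ^+ l)%MS.
  move=> l4 sU; have := @no_picket 3 l s; rewrite X3 adds0mx; apply => //.
    by rewrite l4.
  by rewrite mulmx0.
have UX2 : U *m X ^+ 2 = 0.
  apply: zero_of_rows => w wU.
  by have := pick 3 w isT; rewrite X3 X0 mulmx0 mulmx1 => /(_ wU)/submx0null.
rewrite -[X ^+ 2]mul1mx; apply: zero_of_rows => s _.
have sU : (s *m X ^+ 2 <= U)%MS.
  have := pick 0 s isT; rewrite X0 mulmx1; apply.
  by rewrite X3 mulmx0 sub0mx.
have /submx_powP[w wU sw] := pick 1 s isT sU.
rewrite X1 in sw.
have /submx_powP[w'] := no_pair_n_1_order2 (n := 1) isT X3 wU sw.
rewrite sub_capmx => /andP[w'U /submxP[h w'h]] ->; rewrite w'h mulX2.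
by have := pick 2 h isT; rewrite X1 -w'h UX2 => /(_ w'U)/submx0null.
Qed.

Lemma no_endo_zero (s : 'rV[k]_d.+1) : s = 0.
Proof.
have X2 := square_zero.
have pick2 l (w : 'rV_d.+1) : (l <= 2)%N -> (w *m X ^+ (2 - l) <= U)%MS ->
    (w *m X <= U *m X ^+ l)%MS.
  move=> l2 wU; have := @no_picket 2 l w; rewrite X2 adds0mx X1; apply => //.
    by rewrite l2.
  by rewrite mulmx0.
have UX : U *m X = 0.
  apply: zero_of_rows => w wU.
  by have := pick2 2 w isT; rewrite X2 X0 mulmx0 mulmx1 => /(_ wU)/submx0null.
have X0' : X = 0.
  rewrite -[X]mul1mx; apply: zero_of_rows => w _.
  have wU : (w *m X <= U)%MS.
    have := pick2 0 w isT; rewrite X0 mulmx1; apply.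
    by rewrite X2 mulmx0 sub0mx.
  by have := pick2 1 w isT; rewrite X1 UX => /(_ wU)/submx0null.
have pick1 l (w : 'rV_d.+1) : (l <= 1)%N -> (w *m X ^+ (1 - l) <= U)%MS ->
    (w <= U *m X ^+ l)%MS.
  move=> l1 wU; have := @no_picket 1 l w; rewrite X0 X1 {1 3}X0' adds0mx mulmx1.
  by apply; rewrite ?l1 ?mulmx0.
have /pick1 : (s *m X ^+ (1 - 0) <= U)%MS by rewrite X1 X0' mulmx0 sub0mx.
rewrite X0 mulmx1 => /(_ isT) sU.
by have := pick1 1 s isT; rewrite X0 X1 UX mulmx1 => /(_ sU)/submx0null.
Qed.

End SubmodulePairs.

Section Decomposition.

Variable k : fieldType.

Lemma split_idempotent d (e : 'M[k]_d) : e *m e = e ->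
  exists r (L : 'M_(d, r)) (R : 'M_(r, d)),
    [/\ r = \rank e, L *m R = e & R *m L = 1%:M].
Proof.
move=> ee; exists (\rank e), (col_base e), (row_base e).
split=> //; first exact: mulmx_base.
have [L' L'L] := row_fullP (col_base_full e).
have [R' RR'] := row_freeP (row_base_free e).
have : (col_base e *m row_base e) *m (col_base e *m row_base e) =
       col_base e *m row_base e by rewrite mulmx_base.
move: (col_base e) (row_base e) L'L RR' => L R L'L RR' E.
have := congr1 (fun Y => L' *m Y *m R') E.
by rewrite !mulmxA L'L mul1mx -!mulmxA RR' mulmx1.
Qed.

(** Indecomposable pairs over k[X]/X^4 have bounded size; the bound is expressed by
    writing the identity as a sum of endomorphisms of rank at most 6.  As long as
    V is nonzero, a low rank endomorphism with a fixed vector exists, its Fitting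
    idempotent f splits off a summand, and induction applies to the image of
    1 - f, with coordinates given by a factorization 1 - f = L R, R L = 1. *)
Theorem low_rank_decomposition d u (X : 'M[k]_d) (U : 'M_(u, d)) :
    X *m X *m X *m X = 0 -> stablemx U X ->
  exists2 l : seq 'M_d,
    forall p, p \in l -> [/\ X *m p = p *m X, stablemx U p & (\rank p <= 6)%N]
    & \sum_(p <- l) p = 1%:M.
Proof.
elim/ltn_ind: d => -[|d] IH in u X U *.
  by move=> _ _; exists [::] => //; apply/matrixP => -[].
move=> X4 UX.
have [p [v [Xp Up p6 [vp v0]]]] : exists (p : 'M[k]_d.+1) (v : 'rV[k]_d.+1),
    [/\ X *m p = p *m X, stablemx U p, (\rank p <= 6)%N & v *m p = v /\ v != 0].
  apply: contrapT => no; have Xe4 : X ^+ 4 = 0.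
    by rewrite -X4 /= !mulmxE !exprSr expr0 mul1r.
  have := @no_endo_zero k d u X U UX _ Xe4 (const_mx 1); move=> /(_ _) H.
  suff: const_mx 1 = 0 :> 'rV[k]_d.+1.
    by move/matrixP/(_ 0 0)/eqP; rewrite !mxE oner_eq0.
  apply: H => p v Xp Up p6 vp; apply: contrapT => /eqP v0.
  by apply: no; exists p, v.
have [q /= [ff vf]] := fitting_idempotent v0 vp.
set f := horner_mx p _ in ff vf.
have Xf : X *m f = f *m X by apply: comm_mx_horner.
have Uf : stablemx U f.
  rewrite -(eqmxMr _ (genmxE U)) -(genmxE U); apply: horner_mx_stable.
  by rewrite (eqmxMr _ (genmxE U)) genmxE.
have f6 : (\rank f <= 6)%N.
  rewrite /f rmorphM /= horner_mx_X; exact: leq_trans (mxrankM_maxr _ _) p6.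
pose e : 'M[k]_d.+1 := 1%:M - f.
have ee : e *m e = e by rewrite /e mulmxBr mulmx1 mulmxBl mul1mx ff subrr subr0.
have Xe : X *m e = e *m X by rewrite mulmxBr mulmxBl mulmx1 mul1mx Xf.
have Ue : stablemx U e.
  by rewrite mulmxBr mulmx1 addmx_sub ?submx_refl // -mulmxN stablemxN.
have [r [L [R [rE LR RL]]]] := split_idempotent ee.
have re : (r < d.+1)%N.
  rewrite rE.
  rewrite ltn_neqAle rank_leq_row andbT; apply/negP => /row_freeP[e' ee'].
  case/eqP: v0; rewrite -[v]mulmx1 -ee' mulmxA /e mulmxBr mulmx1 vf subrr.
  by rewrite mul0mx.
have [Y YE] : exists Y, Y = R *m X *m L by exists (R *m X *m L).
have XL : X *m L = L *m Y.
  by rewrite YE !mulmxA LR -Xe -LR -!mulmxA RL mulmx1.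
have RX : R *m X = Y *m R.
  by rewrite YE -[_ *m L *m R]mulmxA LR -mulmxA Xe -LR !mulmxA RL mul1mx.
have [||l lP l1] := IH _ re u Y (U *m L).
- have L4 : X *m X *m X *m X *m L = L *m (Y *m Y *m Y *m Y).
    have XLm m (Z : 'M_(_, m)) : X *m (L *m Z) = L *m (Y *m Z).
      by rewrite !mulmxA XL.
    by rewrite -!mulmxA XL !XLm.
  by rewrite -[LHS]mul1mx -RL -mulmxA -L4 X4 mul0mx mulmx0.
- by rewrite -mulmxA -XL mulmxA submxMr.
exists (f :: [seq L *m p' *m R | p' <- l]).
  move=> p'; rewrite inE => /orP[/eqP-> //|/mapP[{}p' /lP[Xp' Up' p'6] ->]].
  split.
  - by rewrite !mulmxA XL -(mulmxA L Y) Xp' -!mulmxA RX.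
  - rewrite !mulmxA; apply: submx_trans (submxMr _ Up') _.
    by rewrite -mulmxA LR.
  - exact: leq_trans (leq_trans (mxrankM_maxl _ _) (mxrankM_maxr _ _)) p'6.
rewrite big_cons big_map -mulmx_suml -mulmx_sumr l1 mulmx1 LR /e addrC subrK //.
Qed.

End Decomposition.

(** * Endomorphisms of modules over k[X]/X^2 *)

Section Homotopy.

Variables (k : fieldType) (d : nat).

Lemma generalized_inverse (A : 'M[k]_d) : exists B, A *m B *m A = A.
Proof. by exists (pinvmx A); rewrite mulmxKpV. Qed.

(** Over k[X]/X^2 the maps th X + X th are those factoring through a free module.
    Modulo these every module is its homology ker X / im X, a mere vector space,
    where every endomorphism G has a generalized inverse. *)
Lemma regular_mod_homotopy (X G : 'M[k]_d) : X *m X = 0 -> X *m G = G *m X ->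
  exists g th, [/\ g *m X = 0, X *m g = 0 & G = G *m g *m G + (th *m X + X *m th)].
Proof.
move=> XX XG; have [t XtX] := generalized_inverse X.
(* r projects onto a complement of im X in ker X. *)
have [r rE] : exists r, r = 1%:M - (X *m t + t *m X) by eexists.
have r1 : 1%:M - r = X *m t + t *m X by rewrite rE opprB addrC subrK.
have Xr : X *m r = 0.
  by rewrite rE mulmxBr mulmx1 mulmxDr !mulmxA XX mul0mx add0r XtX subrr.
have rX : r *m X = 0.
  by rewrite rE mulmxBl mul1mx mulmxDl -(mulmxA t) XX mulmx0 addr0 XtX subrr.
have htp Q : X *m Q = Q *m X ->
    exists th, Q - r *m Q *m r = th *m X + X *m th.
  move=> XQ; exists (t *m Q + r *m Q *m t).
  have -> : Q - r *m Q *m r = (1%:M - r) *m Q + r *m Q *m (1%:M - r).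
    by rewrite mulmxBl mul1mx mulmxBr mulmx1 addrA subrK.
  rewrite r1 !mulmxDl !mulmxDr !mulmxA Xr !mul0mx addr0.
  rewrite -(mulmxA r Q X) -XQ !mulmxA rX !mul0mx add0r -(mulmxA t X) XQ !mulmxA.
  by rewrite -addrA addrC.
have [g KgK] := generalized_inverse (r *m G *m r).
have [ga gaE] : exists ga, ga = r *m g *m r by eexists.
have gaX : ga *m X = 0 by rewrite gaE -mulmxA rX mulmx0.
have Xga : X *m ga = 0 by rewrite gaE !mulmxA Xr !mul0mx.
have [th1 E1] := htp _ XG.
have [|th2 E2] := htp (G *m ga *m G).
  by rewrite !mulmxA XG -(mulmxA G X) Xga mulmx0 mul0mx -(mulmxA _ G X) -XG mulmxA
    -(mulmxA G ga) gaX mulmx0 mul0mx.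
exists ga, (th1 - th2); split=> //.
have KE : r *m G *m r = r *m (G *m ga *m G) *m r.
  by rewrite -{1}KgK gaE !mulmxA.
rewrite mulmxBl mulmxBr addrACA -E1 -opprD -E2 KE opprB addrA [X in _ = X]addrC.
by rewrite addrA subrK addrC subrK.
Qed.

End Homotopy.

(** * Separability data of a pair of bimodules *)

Section SeparabilityData.

Variables (k : fieldType) (A B : falgType k).
Variables (N : bimodType B A) (M : bimodType A B).

Lemma bract0 (C D : falgType k) (P : bimodType C D) (b : D) : bract (0 : P) b = 0.
Proof. by apply: (addrI (bract 0 b)); rewrite -bractDl !addr0. Qed.

Lemma tens_sum (t : tensor N M) :
  exists l : seq (N * M), t = \sum_(x <- l) tens x.1 x.2.
Proof.
elim/tens_ind: t => [n m|s t [ls ->] [lt ->]].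
  by exists [:: (n, m)]; rewrite big_seq1.
exists (ls ++ [seq (- x.1, x.2) | x <- lt]).
rewrite big_cat big_map /= -sumrN; congr (_ + _); apply: eq_bigr => x _.
have [tDl _ _] := tens_balanced N M.
apply/eqP; rewrite -subr_eq0 -opprD oppr_eq0 -tDl subrr.
by rewrite -[tens 0 _](addrK (tens 0 x.2)) -tDl addr0 subrr.
Qed.

(** What the splitting of the map N (x)_A M -> B provides: the pairing pr is the
    projection onto B, the list l is a tensor mapped to 1, and the last condition
    says that this tensor is central, tested on all balanced maps. *)
Definition separability_data (l : seq (N * M)) (pr : N -> M -> B) : Prop :=
  [/\ balanced pr,
      forall b n m, pr (b *: n) m = b * pr n m,
      forall n m b, pr n (bract m b) = pr n m * b,
      \sum_(x <- l) pr x.1 x.2 = 1 &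
      forall (V : zmodType) (f : N -> M -> V), balanced f -> forall b,
        \sum_(x <- l) f (b *: x.1) x.2 = \sum_(x <- l) f x.1 (bract x.2 b)].

Lemma tens_lift_sum (V : zmodType) (f : N -> M -> V) (l : seq (N * M)) :
  balanced f ->
  tens_lift f (\sum_(x <- l) tens x.1 x.2) = \sum_(x <- l) f x.1 x.2.
Proof.
move=> bf; have fB := tens_liftB bf.
have f0 : tens_lift f 0 = 0 by rewrite -[X in tens_lift f X](subrr 0) fB subrr.
have fD s t : tens_lift f (s + t) = tens_lift f s + tens_lift f t.
  by rewrite -[t]opprK fB -[- t]sub0r !fB f0 !sub0r !opprK.
rewrite (big_morph _ fD f0); apply: eq_bigr => x _; exact: tens_liftE.
Qed.

Lemma retract_data (Y : bimodType B B) : bimod_iso (tensor N M) (B^o * Y)%type ->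
  exists l pr, separability_data l pr.
Proof.
case=> f [[g fK gK] f_ract].
pose t0 := g (1, 0).
have central b : b *: t0 = bract t0 b.
  apply: (can_inj fK); rewrite linearZ f_ract gK.
  congr (_, _); first by rewrite /= /GRing.scale /= mulr1 -[RHS]/(1 * b) mul1r.
  by rewrite /= scaler0 bract0.
have [l t0E] := tens_sum t0.
have [tDl tDr tM] := tens_balanced N M.
exists l, (fun n m => (f (tens n m)).1 : B).
split.
- by split=> *; rewrite ?tDl ?tDr ?tM ?linearD.
- move=> b n m; have -> : tens (b *: n) m = b *: (tens n m : tensor N M).
    by rewrite -tens_scaleE.
  by rewrite linearZ.
- move=> n m b; have -> : tens n (bract m b) = bract (tens n m : tensor N M) b.
    by rewrite -tens_ractE.
  by rewrite f_ract.
- have : (f t0).1 = 1 :> B by rewrite gK.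
  by rewrite t0E linear_sum /= => <-; elim/big_rec2: _ => //= x s t _ ->.
move=> V h bh b; pose lb := [seq (b *: x.1, x.2) | x <- l].
pose lr := [seq (x.1, bract x.2 b) | x <- l].
have -> : \sum_(x <- l) h (b *: x.1) x.2 = \sum_(x <- lb) h x.1 x.2.
  by rewrite big_map.
have -> : \sum_(x <- l) h x.1 (bract x.2 b) = \sum_(x <- lr) h x.1 x.2.
  by rewrite big_map.
rewrite -(tens_lift_sum lb bh) -(tens_lift_sum lr bh); congr (tens_lift h _).
rewrite !big_map /=.
have := central b; rewrite t0E scaler_sumr.
rewrite (eq_bigr (fun x => tens (b *: x.1) x.2)); last first.
  by move=> x _; rewrite -tens_scaleE.
move=> ->.
rewrite (big_morph (fun t : tensor N M => bract t b) (fun s t => bractDl s t b)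
  (bract0 _ b)).
by apply: eq_bigr => x _; rewrite -tens_ractE.
Qed.

End SeparabilityData.

(** * Coordinates on Hom(N, Z) *)

(** A subspace of k^D given by a predicate is the row space of a matrix, namely of
    one of maximal rank among those with independent rows in the subspace. *)
Lemma subspace_basis (k : fieldType) D (P : 'rV[k]_D -> Prop) :
    P 0 -> (forall a u v, P u -> P v -> P (a *: u + v)) ->
  exists d (S : 'M_(d, D)), row_free S /\ (forall v, P v <-> (v <= S)%MS).
Proof.
move=> P0 PZ.
pose Q d := `[< exists S : 'M[k]_(d, D), row_free S /\ forall i, P (row i S) >].
have Q0 : exists d, Q d.
  by exists 0; apply/asboolP; exists 0; split=> [|[]//]; rewrite /row_free mxrank0.
have Qle d : Q d -> (d <= D)%N.
  by move=> /asboolP[S [/eqP dE _]]; rewrite -dE rank_leq_col.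
case: (ex_maxnP Q0 Qle) => d /asboolP[S [freeS PS]] dmax.
exists d, S; split=> // v; split=> [Pv|/submxP[c ->]]; last first.
  rewrite mulmx_sum_row; elim/big_rec: _ => // i w _ Pw; exact: PZ.
case: (boolP (v <= S)%MS) => // vS; suff /dmax : Q d.+1 by rewrite ltnn.
apply/asboolP; exists (col_mx v S : 'M_(1 + d, D)); split=> [|i].
  rewrite /row_free eqn_leq rank_leq_row /=.
  have /eqP dE := freeS; rewrite -[X in (X < _)%N]dE.
  apply: rank_ltmx; rewrite ltmxE (@col_mx_sub _ 1 d) (negPf vS) andbT.
  apply/submxP; exists (row_mx (0 : 'M_(d, 1)) 1%:M : 'M_(d, 1 + d)).
  by rewrite [RHS](mul_row_col (0 : 'M_(d, 1))) mul0mx add0r mul1mx.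
have [j ->|j ->] := @split_ordP 1 d i.
  by rewrite (rowKu j v S); have -> : row j v = v by apply/rowP => a; rewrite mxE ord1.
by rewrite (rowKd j v S).
Qed.

Section HomCoordinates.

Variables (k : fieldType) (A B : falgType k) (N : bimodType B A) (z : nat).
Variable rho : B -> 'M[k]_z.

(** Each row of h is a B-linear map from N to the B-module of row vectors of
    length z on which b acts by right multiplication with rho b. *)
Definition hom_rows m (h : N -> 'M[k]_(m, z)) : Prop :=
  (forall n n', h (n + n') = h n + h n') /\
  (forall b n, h (b *: n) = h n *m rho b).

(** The rows of Phi form a basis of the space of B-linear maps N -> k^z, which is
    finite dimensional because such a map is determined on generators of N. *)
Lemma hom_coordinates : fin_gen N ->
  exists d (Phi : N -> 'M[k]_(d, z)),
  [/\ hom_rows Phi,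
      forall m (h : N -> 'M_(m, z)), hom_rows h ->
        exists C, forall n, h n = C *m Phi n &
      forall m (C C' : 'M_(m, d)), (forall n, C *m Phi n = C' *m Phi n) -> C = C'].
Proof.
case=> r [e egen].
pose ev (h : N -> 'rV[k]_z) : 'rV_(r * z) := mxvec (\matrix_i h (e i)).
have evP a (h h' : N -> 'rV[k]_z) : ev (fun n => a *: h n + h' n) = a *: ev h + ev h'.
  rewrite -linearP; congr mxvec; apply/row_matrixP => i.
  by rewrite linearP /= !rowK.
have hom0 m (h : N -> 'M_(m, z)) : hom_rows h -> h 0 = 0.
  by case=> hD _; apply: (addrI (h 0)); rewrite -hD !addr0.
have ev_inj h h' : hom_rows h -> hom_rows h' -> ev h = ev h' -> h =1 h'.
  move=> hh hh' /(can_inj mxvecK)/row_matrixP E n.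
  have {}E i : h (e i) = h' (e i) by have := E i; rewrite !rowK.
  have [c ->] := egen n; case: (hh) (hh') => hD hZ [hD' hZ'].
  rewrite (big_morph h hD (hom0 _ _ hh)) (big_morph h' hD' (hom0 _ _ hh')).
  by apply: eq_bigr => i _; rewrite hZ hZ' E.
pose P v := exists2 h, hom_rows h & v = ev h.
have h0 : hom_rows (fun _ : N => 0 : 'rV[k]_z).
  by split=> *; rewrite ?addr0 ?mul0mx.
have homP a (h h' : N -> 'rV[k]_z) : hom_rows h -> hom_rows h' ->
    hom_rows (fun n => a *: h n + h' n).
  move=> [hD hZ] [hD' hZ']; split=> *.
    by rewrite hD hD' scalerDr addrACA.
  by rewrite hZ hZ' mulmxDl scalemxAl.
have ev0 : ev (fun _ => 0) = 0.
  by rewrite -(linear0 mxvec); congr mxvec; apply/matrixP => i j; rewrite !mxE.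
have [||d [S [freeS PS]]] := @subspace_basis k (r * z) P.
- by exists (fun _ => 0).
- move=> a _ _ [h hh ->] [h' hh' ->]; exists (fun n => a *: h n + h' n) => //.
  exact: homP.
have /boolp.choice[g gP] : forall i : 'I_d, exists h, hom_rows h /\ row i S = ev h.
  by move=> i; have /PS[h hh E] := row_sub i S; exists h.
have ev_sum (c : 'rV_d) : let h := fun n => \sum_i c 0 i *: g i n in
    hom_rows h /\ ev h = c *m S.
  have -> : c *m S = \sum_i c 0 i *: ev (g i).
    by rewrite mulmx_sum_row; apply: eq_bigr => i _; rewrite (gP i).2.
  elim: (index_enum _) => [|i s [IHh IHe]].
    split; last by rewrite big_nil -ev0; congr ev; apply/funext => n; rewrite big_nil.
    by have -> : (fun n => \sum_(i <- [::]) c 0 i *: g i n) = fun _ => 0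
      by apply/funext => n; rewrite big_nil.
  have -> : (fun n => \sum_(j <- i :: s) c 0 j *: g j n) =
            fun n => c 0 i *: g i n + \sum_(j <- s) c 0 j *: g j n.
    by apply/funext => n; rewrite big_cons.
  split; first by apply: homP => //; case: (gP i).
  by rewrite (evP _ (g i) (fun n => \sum_(j <- s) c 0 j *: g j n)) IHe big_cons.
pose Phi n : 'M[k]_(d, z) := \matrix_i g i n.
have PhiE (c : 'rV_d) n : c *m Phi n = \sum_i c 0 i *: g i n.
  by rewrite mulmx_sum_row; apply: eq_bigr => i _; rewrite rowK.
exists d, Phi; split.
- split=> [n n'|b n]; apply/row_matrixP => i; rewrite ?row_mul ?linearD /= !rowK.
    by case: (gP i) => -[-> _].
  by case: (gP i) => -[_ ->].
- move=> m h [hD hZ]; have /boolp.choice[c cP] : forall i : 'I_m,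
      exists c : 'rV_d, forall n, row i (h n) = c *m Phi n.
    move=> i; have hi : hom_rows (fun n => row i (h n)).
      by split=> *; rewrite ?hD ?hZ ?linearD ?row_mul.
    have /PS/submxP[c cE] : P (ev (fun n => row i (h n))) 
      by exists (fun n => row i (h n)).
    have [hc ec] := ev_sum c.
    exists c => n; rewrite PhiE; apply: (ev_inj _ _ hi hc).
    by rewrite ec -cE.
  by exists (\matrix_i c i) => n; apply/row_matrixP => i; rewrite row_mul rowK cP.
- move=> m C C' E; apply/row_matrixP => i; apply: (row_free_inj freeS).
  rewrite -(ev_sum _).2 -(ev_sum _).2; congr ev; apply/funext => n.
  by rewrite -!PhiE -!row_mul E.
Qed.

End HomCoordinates.

(** * Transfer of endomorphisms *)

(** Left modules written as row vectors turn products around. *)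
Definition row_rep (k : fieldType) (B : falgType k) z (rho : B -> 'M[k]_z) : Prop :=
  [/\ rho 1 = 1%:M, forall b c, rho (b * c) = rho c *m rho b &
      forall b c, rho (b + c) = rho b + rho c].

Section Transfer.

Variables (k : fieldType) (A B : falgType k).
Variables (N : bimodType B A) (M : bimodType A B).
Variables (l : seq (N * M)) (pr : N -> M -> B) (z d : nat).
Variables (rho : B -> 'M[k]_z) (Phi : N -> 'M[k]_(d, z)).
Variables (X : A -> 'M[k]_d) (P : M -> 'M[k]_(z, d)).

(** The rows of Phi are a basis of V = Hom_B(N, k^z).  The matrix X a gives the
    action of a on V, induced by the right action on N, and P m sends z to the map
    n |-> <n, m> z, both in the coordinates given by Phi. *)
Definition hom_data : Prop :=
  [/\ hom_rows rho Phi,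
      forall m (h : N -> 'M_(m, z)), hom_rows rho h ->
        exists C, forall n, h n = C *m Phi n,
      forall m (C C' : 'M_(m, d)), (forall n, C *m Phi n = C' *m Phi n) -> C = C',
      forall a n, Phi (bract n a) = X a *m Phi n &
      forall n m, rho (pr n m) = P m *m Phi n].

(** The endomorphism z |-> sum_j e(n |-> <n, m_j> z)(n_j) of k^z attached to an
    endomorphism e of V = Hom_B(N, k^z). *)
Definition sep_transfer (e : 'M[k]_d) : 'M[k]_z :=
  \sum_(x <- l) P x.2 *m e *m Phi x.1.

Hypotheses (sep : separability_data l pr) (rep : row_rep rho) (hd : hom_data).

Let PhiD n n' : Phi (n + n') = Phi n + Phi n'.
Proof. by case: hd => -[]. Qed.
Let PhiZ b n : Phi (b *: n) = Phi n *m rho b.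
Proof. by case: hd => -[]. Qed.
Let PhiX a n : Phi (bract n a) = X a *m Phi n.
Proof. by case: hd. Qed.
Let rhoP n m : rho (pr n m) = P m *m Phi n.
Proof. by case: hd. Qed.
Let PhiI m (C C' : 'M_(m, d)) : (forall n, C *m Phi n = C' *m Phi n) -> C = C'.
Proof. by case: hd => _ _ /(_ m C C'). Qed.

Lemma hom_actM a b : X (a * b) = X b *m X a.
Proof. by apply: PhiI => n; rewrite -PhiX bractM !PhiX mulmxA. Qed.

Lemma hom_act1 : X 1 = 1%:M.
Proof. by apply: PhiI => n; rewrite -PhiX bract1 mul1mx. Qed.

Lemma hom_actD a b : X (a + b) = X a + X b.
Proof. by apply: PhiI => n; rewrite -PhiX bractDr PhiD !PhiX mulmxDl. Qed.

Lemma hom_act_alg (rhoA : forall c : k, rho c%:A = c%:M) (c : k) : X c%:A = c%:M.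
Proof.
apply: PhiI => n; rewrite -PhiX -bimod_central PhiZ rhoA.
by rewrite mul_mx_scalar mul_scalar_mx.
Qed.

Lemma probeD m m' : P (m + m') = P m + P m'.
Proof.
case: sep rep => -[_ prDr _] _ _ _ _ [_ _ rhoD].
by apply: PhiI => n; rewrite mulmxDl -!rhoP prDr rhoD.
Qed.

Lemma probe_scale a m : P (a *: m) = P m *m X a.
Proof.
case: sep => -[_ _ prM] _ _ _ _.
by apply: PhiI => n; rewrite -mulmxA -PhiX -!rhoP prM.
Qed.

Lemma probe_bract m b : P (bract m b) = rho b *m P m.
Proof.
case: sep rep => _ _ prb _ _ [_ rhoM _].
by apply: PhiI => n; rewrite -mulmxA -!rhoP prb rhoM.
Qed.

Lemma transferD e e' : sep_transfer (e + e') = sep_transfer e + sep_transfer e'.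
Proof.
rewrite /sep_transfer -big_split; apply: eq_bigr => x _ /=.
by rewrite mulmxDr mulmxDl.
Qed.

Lemma transfer0 : sep_transfer 0 = 0.
Proof. by rewrite /sep_transfer big1 // => x _; rewrite mulmx0 mul0mx. Qed.

Lemma transfer_sum (s : seq 'M_d) :
  sep_transfer (\sum_(e <- s) e) = \sum_(e <- s) sep_transfer e.
Proof. exact: (big_morph _ transferD transfer0). Qed.

Lemma transfer1 : sep_transfer 1%:M = 1%:M.
Proof.
case: sep rep => -[prD _ _] _ _ pr1 _ [rho1 _ rhoD].
rewrite -rho1 -pr1 (big_morph rho rhoD (_ : rho 0 = 0)).
  by apply: eq_bigr => x _; rewrite mulmx1 rhoP.
by apply: (addrI (rho 0)); rewrite -rhoD !addr0.
Qed.

Lemma transfer_balanced e : (forall a, X a *m e = e *m X a) ->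
  balanced (fun (n : N) (m : M) => P m *m e *m Phi n).
Proof.
move=> eX; split=> [n n' m|n m m'|n a m].
- by rewrite PhiD mulmxDr.
- by rewrite probeD !mulmxDl.
- by rewrite PhiX probe_scale !mulmxA -(mulmxA (P m) e) -eX mulmxA.
Qed.

(** Centrality of the tensor sum_j n_j (x) m_j is what makes the transfer
    B-linear. *)
Lemma transfer_comm e b : (forall a, X a *m e = e *m X a) ->
  rho b *m sep_transfer e = sep_transfer e *m rho b.
Proof.
case: sep => _ _ _ _ casimir /transfer_balanced /casimir /(_ b) E.
rewrite /sep_transfer mulmx_sumr mulmx_suml.
under eq_bigr do rewrite !mulmxA -probe_bract.
by rewrite -E; apply: eq_bigr => x _; rewrite PhiZ mulmxA.
Qed.

Lemma rank_transfer e : (\rank (sep_transfer e) <= size l * \rank e)%N.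
Proof.
rewrite /sep_transfer; elim: l => [|x s IH]; first by rewrite big_nil mxrank0.
rewrite big_cons /= mulSn; apply: leq_trans (mxrank_add _ _) (leq_add _ IH).
exact: leq_trans (mxrankM_maxl _ _) (mxrankM_maxr _ _).
Qed.

(** A submodule W of k^z gives the submodule U of those maps in Hom_B(N, k^z)
    which have their image in W. *)
Lemma transfer_stable w (W : 'M_(w, z)) : (forall b, stablemx W (rho b)) ->
  exists u (U : 'M_(u, d)), (forall a, stablemx U (X a)) /\
    forall e, stablemx U e -> stablemx W (sep_transfer e).
Proof.
move=> Wrho; pose Q (c : 'rV[k]_d) := forall n, (c *m Phi n <= W)%MS.
have [||u [U [_ UQ]]] := @subspace_basis k d Q.
- by move=> n; rewrite mul0mx sub0mx.
- move=> a v v' Qv Qv' n; rewrite mulmxDl -scalemxAl.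
  by rewrite addmx_sub ?scalemx_sub.
have subU m (C : 'M_(m, d)) : (C <= U)%MS <-> forall n, (C *m Phi n <= W)%MS.
  split=> [/submxP[D ->] n|CW].
    rewrite -mulmxA; apply: mulmx_sub; apply/row_subP => i; rewrite row_mul.
    by apply: (proj2 (UQ _)); exact: row_sub.
  by apply/row_subP => i; apply: (proj1 (UQ _)) => n; rewrite -row_mul;
     apply: submx_trans (row_sub _ _) (CW n).
exists u, U; split=> [a|e Ue].
  by apply/subU => n; rewrite -mulmxA -PhiX; apply: (proj1 (subU _ U)).
rewrite /sep_transfer mulmx_sumr; apply: summx_sub => x _; rewrite !mulmxA.
have WU : (W *m P x.2 <= U)%MS.
  by apply/subU => n; rewrite -mulmxA -rhoP.
have := submx_trans (submxMr e WU) Ue.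
by move/subU/(_ x.1).
Qed.

End Transfer.

Lemma hom_data_exists (k : fieldType) (A B : falgType k)
    (N : bimodType B A) (M : bimodType A B) (pr : N -> M -> B)
    (l : seq (N * M)) z (rho : B -> 'M[k]_z) :
  fin_gen N -> separability_data l pr -> row_rep rho ->
  exists d Phi X P, @hom_data k A B N M pr z d rho Phi X P.
Proof.
move=> fgN [[prDl _ _] prZ _ _ _] [_ rhoM rhoD].
have [d [Phi [homPhi PhiE PhiI]]] := hom_coordinates rho fgN.
have /boolp.choice[X XE] : forall a, exists C, forall n, Phi (bract n a) = C *m Phi n.
  move=> a; apply: PhiE; case: homPhi => PhiD PhiZ; split=> *.
    by rewrite bractDl PhiD.
  by rewrite -scale_ract PhiZ.
have /boolp.choice[P PE] : forall m, exists C, forall n, rho (pr n m) = C *m Phi n.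
  by move=> m; apply: PhiE; split=> *; rewrite ?prDl ?rhoD ?prZ ?rhoM.
by exists d, Phi, X, P.
Qed.

(** * Group algebras of cyclic 2-groups *)

Lemma exp2n_add1 (R : pzRingType) (x : R) n :
  (forall y : R, y + y = 0) -> (x + 1) ^+ (2 ^ n) = x ^+ (2 ^ n) + 1.
Proof.
move=> R2; elim: n => [|n IH]; first by rewrite !expr1.
rewrite expnSr !exprM IH sqrrD1 mulr2n R2 addr0 //.
Qed.

Section GroupAlgebraFacts.

Variables (k : fieldType) (gT : finGroupType).
Local Notation kG := (group_algebra k gT).

Definition ga_delta (x : gT) : kG := [ffun y => (y == x)%:R].

Lemma ga_val_delta x y : ga_val (ga_delta x) y = (y == x)%:R.
Proof. by rewrite /ga_val ffunE. Qed.

Lemma ga_val_mul (f h : kG) x :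
  ga_val (f * h) x = \sum_y ga_val f y * ga_val h (y^-1 * x)%g.
Proof. exact: ga_valM. Qed.

Lemma ga_delta1 : ga_delta 1%g = 1.
Proof. by apply: ga_ext. Qed.

Lemma ga_val_deltaM x (f : kG) y : ga_val (ga_delta x * f) y = ga_val f (x^-1 * y)%g.
Proof.
rewrite ga_val_mul (bigD1 x) //= ga_val_delta eqxx mul1r big1 ?addr0 // => w.
by rewrite ga_val_delta => /negPf->; rewrite mul0r.
Qed.

Lemma ga_deltaM x y : ga_delta x * ga_delta y = ga_delta (x * y)%g.
Proof.
apply: ga_ext => w; rewrite ga_val_deltaM !ga_val_delta.
by congr (_ %:R); rewrite (can2_eq (mulKVg x) (mulKg x)).
Qed.

Lemma ga_deltaX x i : ga_delta x ^+ i = ga_delta (x ^+ i)%g.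
Proof.
elim: i => [|i IH]; first by rewrite expr0 expg0 ga_delta1.
by rewrite exprS expgS IH ga_deltaM.
Qed.

Lemma ga_sum (f : kG) : f = \sum_x ga_val f x *: ga_delta x.
Proof.
apply: ga_ext => y; rewrite (big_morph (fun h : kG => ga_val h y)
  (fun f g => ga_valD f g y) (_ : _ = 0)); last by rewrite /ga_val ffunE.
rewrite (bigD1 y) //= ga_valZ ga_val_delta eqxx mulr1 big1 ?addr0 // => x.
by rewrite eq_sym => /negPf xy; rewrite ga_valZ ga_val_delta xy mulr0.
Qed.

Hypothesis char2 : 2 \in [pchar k].

Lemma lmod_char2 (V : lmodType k) (v : V) : v + v = 0.
Proof. by rewrite -mulr2n -scaler_nat pcharf0 // scale0r. Qed.

Lemma ga_nilpotent n g : #|[set: gT]| = (2 ^ n)%N -> [set: gT] = <[g]>%g ->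
  (ga_delta g + 1) ^+ (2 ^ n) = 0.
Proof.
move=> card cyc; rewrite exp2n_add1; last exact: lmod_char2.
rewrite ga_deltaX -card cyc -[#|_|]/(#[g]%g) expg_order ga_delta1.
exact: lmod_char2.
Qed.

Section RowRep.

Variables (g : gT) (z : nat) (T : 'M[k]_z).
Hypotheses (cyc : [set: gT] = <[g]>%g) (T1 : T ^+ #|[set: gT]| = 1).

(** A matrix T with the order of T dividing that of the cyclic group makes k^z a
    module on which the generator acts as T. *)
Lemma cyclic_row_rep : exists rho : kG -> 'M[k]_z,
  [/\ row_rep rho, forall b c, rho b *m rho c = rho c *m rho b,
      forall c, rho c%:A = c%:M & rho (ga_delta g) = T].
Proof.
have gen x : exists i, x = (g ^+ i)%g by apply/cycleP; rewrite -cyc inE.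
have /boolp.choice[log logE] := gen.
have TX i j : (g ^+ i = g ^+ j)%g -> T ^+ i = T ^+ j.
  move=> /eqP; rewrite eq_expg_mod_order /order -cyc => /eqP E.
  rewrite (divn_eq i #|[set: gT]|) (divn_eq j #|[set: gT]|) E.
  by rewrite !exprD ![(_ %/ _ * _)%N]mulnC !exprM T1 !expr1n.
pose tau x := T ^+ log x.
have tauX i : tau (g ^+ i)%g = T ^+ i by apply: TX; rewrite -logE.
have tauM x y : tau (x * y)%g = tau x *m tau y.
  by rewrite {1}(logE x) {1}(logE y) -expgD tauX /tau exprD.
have tau1 : tau 1%g = 1 by rewrite -(expg0 g) tauX.
pose rho (b : kG) : 'M[k]_z := \sum_x ga_val b x *: tau x.
have rho_delta x : rho (ga_delta x) = tau x.
  rewrite /rho (bigD1 x) //= ga_val_delta eqxx scale1r big1 ?addr0 // => y.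
  by rewrite ga_val_delta => /negPf->; rewrite scale0r.
have rhoD b c : rho (b + c) = rho b + rho c.
  by rewrite /rho -big_split; apply: eq_bigr => x _; rewrite ga_valD scalerDl.
have rhoZ a b : rho (a *: b) = a *: rho b.
  by rewrite /rho scaler_sumr; apply: eq_bigr => x _; rewrite ga_valZ scalerA.
have rho1 : rho 1 = 1%:M by rewrite -ga_delta1 rho_delta tau1.
have rho0 : rho 0 = 0 by rewrite -(scale0r 0) rhoZ scale0r.
have rho_deltaM x c : rho (ga_delta x * c) = tau x *m rho c.
  rewrite /rho (reindex_inj (mulgI x)) mulmx_sumr; apply: eq_bigr => y _ /=.
  by rewrite ga_val_deltaM mulKg tauM scalemxAr.
have rhoM b c : rho (b * c) = rho b *m rho c.
  rewrite {1}(ga_sum b) mulr_suml (big_morph rho rhoD rho0) {2}/rho mulmx_suml.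
  by apply: eq_bigr => x _; rewrite -scalerAl rhoZ rho_deltaM -scalemxAl.
have rhoC b c : rho b *m rho c = rho c *m rho b.
  rewrite /rho mulmx_suml mulmx_sumr; apply: eq_bigr => x _.
  rewrite mulmx_suml mulmx_sumr; apply: eq_bigr => y _.
  rewrite -!scalemxAl -!scalemxAr !scalerA [_ * ga_val b _]mulrC; congr (_ *: _).
  by rewrite -[LHS]/(_ * _) -[RHS]/(_ * _) -!exprD addnC.
exists rho; split.
- by split=> // b c; rewrite rhoM rhoC.
- exact: rhoC.
- by move=> c; rewrite rhoZ rho1 scalemx1.
- by rewrite rho_delta -{1}(expg1 g) tauX.
Qed.

End RowRep.

Lemma comm_act d (X : kG -> 'M[k]_d) (e : 'M_d) g :
    [set: gT] = <[g]>%g -> (forall a b, X (a * b) = X b *m X a) ->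
    (forall a b, X (a + b) = X a + X b) -> X 1 = 1%:M ->
    (forall c : k, X c%:A = c%:M) ->
  X (ga_delta g) *m e = e *m X (ga_delta g) ->
  forall a, X a *m e = e *m X a.
Proof.
move=> cyc XM XD X1 XA Xe.
have X0 : X 0 = 0 by have := XA 0; rewrite scale0r raddf0.
move=> a; rewrite (ga_sum a) (big_morph X XD X0) mulmx_suml mulmx_sumr.
apply: eq_bigr => x _; rewrite -[ga_delta x]mul1r scalerAl XM XA.
rewrite mul_mx_scalar -scalemxAl -scalemxAr; congr (_ *: _).
have /cycleP[i ->] : x \in <[g]>%g by rewrite -cyc inE.
rewrite -ga_deltaX; elim: i => [|i IH]; first by rewrite expr0 X1 mulmx1 mul1mx.
by rewrite exprS XM -mulmxA Xe mulmxA IH mulmxA.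
Qed.

Lemma stable_act d w (X : kG -> 'M[k]_d) (W : 'M_(w, d)) g :
    [set: gT] = <[g]>%g -> (forall a b, X (a * b) = X b *m X a) ->
    (forall a b, X (a + b) = X a + X b) -> X 1 = 1%:M ->
    (forall c : k, X c%:A = c%:M) ->
  stablemx W (X (ga_delta g)) -> forall a, stablemx W (X a).
Proof.
move=> cyc XM XD X1 XA WX a; rewrite (ga_sum a).
elim/big_rec: _ => [|x b _ IH].
  by have := XA 0; rewrite scale0r raddf0 => ->; rewrite mulmx0 sub0mx.
rewrite XD stablemxD // -[ga_delta x]mul1r scalerAl XM XA mul_mx_scalar.
rewrite -scalemxAr scalemx_sub //.
have /cycleP[i ->] : x \in <[g]>%g by rewrite -cyc inE.
rewrite -ga_deltaX; elim: i => [|i IHi]; first by rewrite expr0 X1 mulmx1.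
by rewrite exprS XM stablemxM.
Qed.

(** With y = g + 1, an element killed by y^2 = g^2 + 1 has coefficients invariant
    under translation by g^2; it equals y^2 c, where c keeps half of the
    coefficients, those at g^i with i = 0 or 1 modulo 4. *)
Lemma ga_annihilator g (b : kG) : (4 %| #|[set: gT]|)%N -> [set: gT] = <[g]>%g ->
  (ga_delta g + 1) ^+ 2 * b = 0 -> exists c, b = (ga_delta g + 1) ^+ 2 * c.
Proof.
move=> N4 cyc; have sq : (ga_delta g + 1) ^+ 2 = ga_delta (g ^+ 2)%g + 1.
  have := @exp2n_add1 kG (ga_delta g) 1 (lmod_char2 (V := kG)).
  by rewrite ga_deltaX.
rewrite sq mulrDl mul1r => b0.
have g2 i : (g ^+ i.+2 = g ^+ 2 * g ^+ i)%g by rewrite -expgD.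
have bg i : ga_val b (g ^+ i.+2)%g = ga_val b (g ^+ i)%g.
  have := congr1 (fun f => ga_val f (g ^+ i.+2)%g) b0; rewrite /= ga_valD ga_val_deltaM.
  rewrite (g2 i) mulKg [ga_val 0 _]ffunE.
  by move/eqP; rewrite addr_eq0 oppr_pchar2 // => /eqP.
have gen x : exists i, x = (g ^+ i)%g by apply/cycleP; rewrite -cyc inE.
have /boolp.choice[log logE] := gen.
have log4 i : (log (g ^+ i)%g %% 4 = i %% 4)%N.
  have /eqP := logE (g ^+ i)%g.
  rewrite eq_expg_mod_order /order -cyc => /eqP E.
  by rewrite -(modn_dvdm i N4) E modn_dvdm.
pose c : kG := [ffun x => if (log x %% 4 < 2)%N then ga_val b x else 0].
have cE i : ga_val c (g ^+ i)%g = if (i %% 4 < 2)%N then ga_val b (g ^+ i)%g else 0.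
  by rewrite /ga_val ffunE log4.
exists c; apply: ga_ext => x; rewrite mulrDl mul1r ga_valD ga_val_deltaM.
have [i xE] : exists i, x = (g ^+ i.+2)%g.
  by have [i E] := gen (g ^- 2 * x)%g; exists i; rewrite (g2 i) -E mulKVg.
rewrite xE {2}(g2 i) mulKg !cE -addn2 -modnDml addn2 -bg.
by have := ltn_pmod i (isT : 0 < 4)%N; case: (i %% 4)%N => [|[|[|[|]]]] //=;
  rewrite ?addr0 ?add0r // bg.
Qed.

End GroupAlgebraFacts.

(** * Annihilators in projective modules *)

Section Projective.

Variables (R : nzRingType) (P : lmodType R) (r : nat) (e : 'I_r -> P).

Definition free_cover (u : 'rV[R]_r) : P := \sum_i u 0 i *: e i.

Fact free_cover_linear : linear free_cover.
Proof.
move=> a u v; rewrite /free_cover scaler_sumr -big_split; apply: eq_bigr => i _ /=.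
by rewrite !mxE scalerDl scalerA.
Qed.

HB.instance Definition _ := GRing.isLinear.Build R 'rV[R]_r P *:%R free_cover
  free_cover_linear.

(** The inclusion in b R of the annihilator of b passes from R to free modules
    coordinatewise, and from there to direct summands. *)
Lemma projective_annihilator (b : R) :
    (forall p, exists c : 'I_r -> R, p = \sum_i c i *: e i) -> projective P ->
    (forall c, b * c = 0 -> exists c', c = b * c') ->
  forall p : P, b *: p = 0 -> exists p', p = b *: p'.
Proof.
move=> egen projP bann p bp.
have [|h hK] := projP _ _ free_cover idfun.
  move=> v; have [c ->] := egen v; exists (\row_i c i).
  by apply: eq_bigr => i _; rewrite mxE.
have hb i : b * h p 0 i = 0.
  have E : h (b *: p) = b *: h p by rewrite linearZ.
  by have := congr1 (fun u : 'rV[R]_r => u 0 i) E; rewrite bp linear0 !mxE => <-.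
have /boolp.choice[c cE] : forall i, exists c', h p 0 i = b * c' by move=> i; apply: bann.
exists (\sum_i c i *: e i); rewrite -[LHS](hK p) /= /free_cover scaler_sumr.
by apply: eq_bigr => i _; rewrite cE scalerA.
Qed.

End Projective.

(** Multiplication by g = 1 + (g + 1) preserves the span of 1 and g + 1. *)
Lemma ga_span2 (k : fieldType) (char2 : 2 \in [pchar k]) (gT : finGroupType) (g : gT)
    (a : group_algebra k gT) :
  [set: gT] = <[g]>%g -> (ga_delta k g + 1) ^+ 2 = 0 ->
  exists al be : k, a = al%:A + be *: (ga_delta k g + 1).
Proof.
set y := ga_delta k g + 1 => cyc y2.
have gE : ga_delta k g = y + 1.
  by rewrite /y -addrA (lmod_char2 char2) addr0.
rewrite (ga_sum a); elim/big_rec: _ => [|x b _ [al [be ->]]].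
  by exists 0, 0; rewrite !scale0r addr0.
have [al' [be' ->]] : exists al be : k, ga_delta k x = al%:A + be *: y.
  have /cycleP[i ->] : x \in <[g]>%g by rewrite -cyc inE.
  rewrite -ga_deltaX; elim: i => [|i [al' [be' IH]]].
    by exists 1, 0; rewrite expr0 scale1r scale0r addr0.
  exists al', (al' + be'); rewrite exprS IH gE mulrDl mul1r mulrDr -!scalerAr.
  by rewrite mulr1 -expr2 y2 scaler0 addr0 addrCA -scalerDl.
exists (ga_val a x * al' + al), (ga_val a x * be' + be).
by rewrite scalerDr !scalerA !scalerDl addrACA.
Qed.

(** * The cyclic group of order 2 *)

(** Let x = g + 1 in A with x^2 = 0 and y = h + 1 in B.  A null-homotopic map
    th X + X th of Hom_B(N, k^z) factors through a free A-module; its transfer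
    therefore factors through a direct sum of copies of N, by maps nu_i from k^z
    to N, the sums of the balanced maps homotopy_map below.  When y^2 kills k^z,
    it kills the image of nu_i, which then lies in y^2 N as N is projective, and
    every B-linear map from N to k^z vanishes there. *)
Section OrderTwo.

Variables (k : fieldType) (gT hT : finGroupType).
Local Notation A := (group_algebra k gT).
Local Notation B := (group_algebra k hT).
Hypothesis char2 : 2 \in [pchar k].
Variables (g : gT) (h : hT) (n : nat).
Hypotheses (gcyc : [set: gT] = <[g]>%g) (gcard : #|[set: gT]| = 2).
Hypotheses (hcyc : [set: hT] = <[h]>%g) (hcard : #|[set: hT]| = (2 ^ n)%N).
Hypothesis n_gt1 : (1 < n)%N.

Let x : A := ga_delta k g + 1.
Let y : B := ga_delta k h + 1.
Let x2 : x ^+ 2 = 0.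
Proof. exact: (ga_nilpotent char2 (n := 1)). Qed.

Variables (N : bimodType B A) (M : bimodType A B).
Variables (l : seq (N * M)) (pr : N -> M -> B) (z d : nat).
Variables (rho : B -> 'M[k]_z) (Phi : N -> 'M[k]_(d, z)).
Variables (X : A -> 'M[k]_d) (P : M -> 'M[k]_(z, d)).
Hypotheses (sep : separability_data l pr) (rep : row_rep rho).
Hypothesis hd : hom_data pr rho Phi X P.
Hypothesis rhoA : forall c : k, rho c%:A = c%:M.
Hypothesis rho_y2 : rho (y ^+ 2) = 0.
Hypotheses (fgN : fin_gen N) (projN : projective N).

Let homotopy_map (th : 'M[k]_d) (ze : 'rV[k]_z) (i : 'I_d) (p : N) (m : M) : N :=
  ((ze *m P m *m th) 0 i)%:A *: bract p x + ((ze *m P m *m X x *m th) 0 i)%:A *: p.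

Let homotopy_map_balanced th ze i : balanced (homotopy_map th ze i).
Proof.
have mxD (u v : 'rV[k]_d) : (u + v) 0 i = u 0 i + v 0 i by rewrite mxE.
have mxZ c (u : 'rV[k]_d) : (c *: u) 0 i = c * u 0 i by rewrite mxE.
rewrite /homotopy_map; split=> [p p' m|p m m'|p a m].
- by rewrite bractDl !scalerDr addrACA.
- rewrite (probeD sep rep hd) !(mulmxDr, mulmxDl) !mxD.
  by rewrite !scalerDl addrACA.
have Xx2 : X x *m X x = 0.
  rewrite -(hom_actM hd) -expr2 x2.
  by have := hom_act_alg hd rhoA 0; rewrite scale0r raddf0.
have [al [be aE]] := ga_span2 char2 a gcyc x2.
have pa : bract p a = al%:A *: p + be%:A *: bract p x.
  rewrite aE bractDr -bimod_central -[be *: _]mulr_algl bractM -bimod_central.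
  by rewrite scale_ract.
have Xa : X a = al%:M + be *: X x.
  rewrite aE (hom_actD hd) (hom_act_alg hd rhoA) -[be *: _]mulr_algl (hom_actM hd).
  by rewrite (hom_act_alg hd rhoA) mul_mx_scalar.
have pax : bract (bract p a) x = al%:A *: bract p x.
  rewrite pa bractDl -!scale_ract -bractM -expr2 x2.
  by rewrite (_ : bract p 0 = 0) ?scaler0 ?addr0 //;
    apply: (addrI (bract p 0)); rewrite -bractDr !addr0.
have algM (c c' : k) : (c * c')%:A = c%:A * c'%:A :> B.
  by rewrite -scalerAl mul1r scalerA.
rewrite (probe_scale sep hd) pax pa Xa !mulmxA.
rewrite !(mulmxDr, mulmxDl) -!(scalemxAl, scalemxAr) !mul_mx_scalar.
rewrite -!(mulmxA _ (X x) (X x)) Xx2 !mulmx0 !mul0mx scaler0 addr0.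
rewrite -!scalemxAl !mxD !mxZ !scalerDl !algM scalerDr !scalerA.
by rewrite -!algM ![_ * al]mulrC ![_ * be]mulrC addrA addrAC.
Qed.

Let algC (c : k) (b : B) : c%:A * b = b * c%:A.
Proof. by rewrite mulr_algl mulr_algr. Qed.

Let nu th (ze : 'rV[k]_z) i : N := \sum_(q <- l) homotopy_map th ze i q.1 q.2.

Let nu_scale th ze i b : b *: nu th ze i = nu th (ze *m rho b) i.
Proof.
rewrite /nu scaler_sumr; have [_ _ _ _ casimir] := sep.
transitivity (\sum_(q <- l) homotopy_map th ze i (b *: q.1) q.2).
  apply: eq_bigr => q _; rewrite /homotopy_map scalerDr !scalerA -!algC.
  by rewrite -scale_ract !scalerA.
rewrite (casimir _ _ (homotopy_map_balanced th ze i)).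
by apply: eq_bigr => q _; rewrite /homotopy_map (probe_bract sep rep hd) !mulmxA.
Qed.

Let Phi_alg (c : k) p : Phi (c%:A *: p) = c *: Phi p.
Proof. by case: hd => -[_ PhiZ] _ _ _ _; rewrite PhiZ rhoA mul_mx_scalar. Qed.

Let PhiD p q : Phi (p + q) = Phi p + Phi q.
Proof. by case: hd => -[]. Qed.

Let transfer_nu (th : 'M_d) (ze : 'rV_z) :
  ze *m sep_transfer l Phi P (th *m X x + X x *m th) =
  \sum_i row i (Phi (nu th ze i)).
Proof.
have Phi0 : Phi 0 = 0 by apply: (addrI (Phi 0)); rewrite -PhiD !addr0.
under eq_bigr do rewrite (big_morph Phi PhiD Phi0) linear_sum /=.
rewrite exchange_big /sep_transfer mulmx_sumr; apply: eq_bigr => q _ /=.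
rewrite !(mulmxDr, mulmxDl) !mulmxA -(mulmxA _ (X x) (Phi q.1)).
have -> : X x *m Phi q.1 = Phi (bract q.1 x) by case: hd.
rewrite (mulmx_sum_row _ (Phi (bract _ _))) (mulmx_sum_row _ (Phi q.1)) -big_split.
by apply: eq_bigr => i _; rewrite /homotopy_map /= PhiD !Phi_alg !linearD !linearZ.
Qed.

Lemma transfer_null_homotopic (th : 'M_d) :
  sep_transfer l Phi P (th *m X x + X x *m th) = 0.
Proof.
apply/row_matrixP => j; rewrite row0 rowE transfer_nu big1 // => i _.
set ze := delta_mx _ _; have y2nu : y ^+ 2 *: nu th ze i = 0.
  rewrite nu_scale rho_y2 mulmx0 /nu big1 // => q _.
  by rewrite /homotopy_map !mul0mx mxE !scale0r addr0.
have [r [e egen]] := fgN.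
have [|p' ->] := projective_annihilator egen projN _ y2nu.
  by move=> c; apply: ga_annihilator; rewrite // hcard (@dvdn_exp2l 2 2 n).
by case: hd => -[_ ->] _ _ _ _; rewrite rho_y2 mulmx0 row0.
Qed.

End OrderTwo.

Lemma unipotent_order (k : fieldType) (char2 : 2 \in [pchar k]) z (Y : 'M[k]_z) n :
  Y ^+ (2 ^ n) = 0 -> (Y + 1) ^+ (2 ^ n) = 1.
Proof. by move=> Yn; rewrite exp2n_add1 ?Yn ?add0r //; exact: lmod_char2. Qed.

(** On the module Z = k[y]/y^2, let G be the action of y on Hom_B(N, Z).  Then
    G = G g G + (null-homotopic), and the transfer turns this into y = y g' y with
    g' commuting with y; so y = y^2 g' = 0 on Z, which is absurd. *)
Theorem order_two_inequivalent (k : fieldType) (gT hT : finGroupType) (n : nat) :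
    2 \in [pchar k] -> cyclic [set: gT] -> #|[set: gT]| = 2 ->
    cyclic [set: hT] -> #|[set: hT]| = (2 ^ n)%N -> (1 < n)%N ->
  ~ separably_equivalent (group_algebra k gT) (group_algebra k hT).
Proof.
move=> char2 /cyclicP[g gcyc] gcard /cyclicP[h hcyc] hcard n_gt1.
case=> M [N] [_] [YB] [_ [fgN projN _ _] _ /retract_data[l [pr sep]]].
pose Y : 'M[k]_2 := delta_mx 0 1.
have Y2 : Y *m Y = 0 by rewrite mul_delta_mx_0.
have Ye2 : Y ^+ 2 = 0 by [].
have T1 : (Y + 1) ^+ #|[set: hT]| = 1.
  rewrite hcard unipotent_order //.
  by rewrite -(subnKC (ltnW n_gt1)) expnD exprM Ye2 expr0n expn_eq0.
have [rho [rep rhoC rhoA rhoh]] := cyclic_row_rep hcyc T1.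
have [rho1 rhoM rhoD] := rep.
have rhoy : rho (ga_delta k h + 1) = Y.
  by rewrite rhoD rhoh rho1 -addrA (lmod_char2 char2) addr0.
have rhoy2 : rho ((ga_delta k h + 1) ^+ 2) = 0 by rewrite expr2 rhoM rhoy.
have [d [Phi [X [P hd]]]] := hom_data_exists fgN sep rep.
have [[PhiD PhiZ] PhiE PhiI PhiX rhoP] := hd.
pose x := ga_delta k g + 1.
have x2 : x ^+ 2 = 0 by exact: (ga_nilpotent char2 (n := 1)).
have X1 := hom_act1 hd; have XD := hom_actD hd; have XM := hom_actM hd.
have XA := hom_act_alg hd rhoA.
have Xx2 : X x *m X x = 0.
  by rewrite -XM -expr2 x2; have := XA 0; rewrite scale0r raddf0.
have [G GE] : exists G, forall p, Phi p *m Y = G *m Phi p.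
  apply: PhiE; split=> [p q|b p]; first by rewrite PhiD mulmxDl.
  by rewrite PhiZ -!mulmxA -rhoy rhoC.
have GX a : X a *m G = G *m X a.
  by apply: PhiI => p; rewrite -!mulmxA -GE -PhiX -GE PhiX mulmxA.
have PG m : P m *m G = Y *m P m.
  apply: PhiI => p; rewrite -mulmxA -GE mulmxA -rhoP -mulmxA -rhoP.
  by rewrite -rhoy rhoC.
have [ga [th [gaX Xga GG]]] := regular_mod_homotopy Xx2 (GX x).
have Xg : X (ga_delta k g) = X x + 1%:M.
  by rewrite -X1 -XD -addrA (lmod_char2 char2) addr0.
have ga_comm : forall a, X a *m ga = ga *m X a.
  apply: (comm_act gcyc XM XD X1 XA).
  by rewrite Xg mulmxDl mulmxDr gaX Xga mul1mx mulmx1.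
have TG e : sep_transfer l Phi P (G *m e) = Y *m sep_transfer l Phi P e.
  rewrite /sep_transfer mulmx_sumr; apply: eq_bigr => q _.
  by rewrite !mulmxA PG.
have TGr e : sep_transfer l Phi P (e *m G) = sep_transfer l Phi P e *m Y.
  rewrite /sep_transfer mulmx_suml; apply: eq_bigr => q _.
  by rewrite -!mulmxA GE.
have TY : sep_transfer l Phi P G = Y.
  by rewrite -[G]mulmx1 TG (transfer1 sep rep hd) mulmx1.
have TgaY : sep_transfer l Phi P ga *m Y = Y *m sep_transfer l Phi P ga.
  by rewrite -rhoy (transfer_comm sep rep hd _ ga_comm).
have := TY; rewrite GG transferD TGr TG -mulmxA TgaY mulmxA Y2 mul0mx add0r.
rewrite (transfer_null_homotopic char2 gcyc gcard hcyc hcard n_gt1 sep rep hd) //.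
by move/matrixP/(_ 0 1)/eqP; rewrite !mxE eq_sym oner_eq0.
Qed.

(** * Large pairs over k[Y]/Y^8 *)

Section ShiftMatrix.

Variables (k : fieldType) (m : nat).

Definition shift_mx : 'M[k]_m.+1 := \matrix_(i, j) (j == i.+1 :> nat)%:R.

Lemma mul_shift0 (w : 'rV_m.+1) : (w *m shift_mx) 0 0 = 0.
Proof. by rewrite mxE big1 // => i _; rewrite mxE mulr0. Qed.

Lemma mul_shiftS (w : 'rV_m.+1) (i j : 'I_m.+1) : j = i.+1 :> nat ->
  (w *m shift_mx) 0 j = w 0 i.
Proof.
move=> ji; rewrite mxE (bigD1 i) //= mxE ji eqxx mulr1 big1 ?addr0 // => a ai.
by rewrite mxE ji eqSS eq_sym val_eqE (negPf ai) mulr0.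
Qed.

Lemma shift_kernel (w : 'rV_m.+1) :
  w *m shift_mx = 0 -> w = w 0 ord_max *: delta_mx 0 ord_max.
Proof.
move=> wJ; apply/rowP => i; rewrite !mxE eqxx /=.
have [->|im] := eqVneq i ord_max; first by rewrite mulr1.
have i1 : (i.+1 < m.+1)%N.
  by have := ltn_ord i; move: im; rewrite -val_eqE /=; lia.
by rewrite mulr0 -(mul_shiftS w (j := Ordinal i1) (i := i)) // wJ mxE.
Qed.

Lemma mul_shift_exp (w : 'rV_m.+1) t (j : 'I_m.+1) :
  (j < t)%N -> (w *m shift_mx ^+ t) 0 j = 0.
Proof.
elim: t j => // t IH j jt; rewrite exprSr mulmxA.
case: (posnP j) => [j0|j0].
  by rewrite (_ : j = 0) ?mul_shift0 //; apply: val_inj.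
have jm : (j.-1 < m.+1)%N by have := ltn_ord j; lia.
rewrite (@mul_shiftS _ (Ordinal jm) j) ?prednK // IH //=; lia.
Qed.

(** The centralizer of a nilpotent Jordan block is a local ring: each matrix in it
    which is not invertible kills the line ker J. *)
Lemma shift_centralizer (s : seq 'M[k]_m.+1) :
    (forall a, a \in s -> shift_mx *m a = a *m shift_mx /\ (\rank a <= m)%N) ->
  \sum_(a <- s) a != 1%:M.
Proof.
move=> sP; apply/eqP => s1; pose v : 'rV[k]_m.+1 := delta_mx 0 ord_max.
have va a : a \in s -> v *m a = 0.
  move=> /sP[Ja ra].
  have [w w0 wa] : exists2 w : 'rV_m.+1, w != 0 & w *m a = 0.
    have : kermx a != 0.
      by rewrite kermx_eq0 /row_free neq_ltn ltnS ra.
    by move=> /rowV0Pn[w /sub_kermxP wa w0]; exists w.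
  have [t] : exists t, w *m shift_mx ^+ t = 0.
    by exists m.+1; apply/rowP => j; rewrite mul_shift_exp // mxE.
  elim: t w w0 wa => [|t IH] w w0 wa.
    by rewrite mulmx1 => wz; rewrite wz eqxx in w0.
  rewrite exprS mulmxA; have [wJ _|wJ] := eqVneq (w *m shift_mx) 0.
    have wE := shift_kernel wJ; move: w0 wa; rewrite wE -scalemxAl => w0 /eqP.
    by rewrite scaler_eq0 => /orP[/eqP c0|/eqP //]; rewrite c0 scale0r eqxx in w0.
  by apply: IH => //; rewrite -mulmxA Ja mulmxA wa mul0mx.
have : v = 0.
  by rewrite -[v]mulmx1 -s1 mulmx_sumr big_seq big1.
by move/rowP/(_ ord_max)/eqP; rewrite !mxE !eqxx oner_eq0.
Qed.

End ShiftMatrix.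

(** The pair (Z, W) over k[Y]/Y^8 attached to J: Z is generated by vectors s_e, r_e,
    q_e of orders 6, 4, 2, with e in E = k^m, and W is generated by the vectors
    Y^2 s_e + Y r_e + q_e and Y^2 r_e + Y q_(eJ).  As a vector space Z consists of
    12 copies of E, the blocks 0 to 5 being Y^i s, the blocks 6 to 9 being Y^i r,
    and the blocks 10 and 11 being Y^i q. *)
Section LargeModule.

Variables (k : fieldType) (m : nat) (J : 'M[k]_m).

Definition block_inj (i : 'I_12) : 'M[k]_(m, 12 * m) := \matrix_a mxvec (delta_mx i a).
Definition block_prj (j : 'I_12) : 'M[k]_(12 * m, m) :=
  \matrix_(c, b) (c == mxvec_index j b)%:R.

Lemma block_inj_prj i j : block_inj i *m block_prj j = (i == j)%:R%:M.
Proof.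
apply/matrixP => a b; rewrite !mxE (bigD1 (mxvec_index j b)) //= !mxE eqxx mulr1.
rewrite -/(mxvec _ 0 _) mxvecE mxE big1 ?addr0 => [|c /negPf cj]; last first.
  by rewrite [X in _ * X]mxE cj mulr0.
by rewrite [j == i]eq_sym [b == a]eq_sym; case: (i == j); case: (a == b).
Qed.

(** Natural indices let the action of Y be written as passing from block i to block
    i + 1; they are meaningful below 12. *)
Definition inj (i : nat) := block_inj (inord i).
Definition prj (i : nat) := block_prj (inord i).

Lemma inj_prj i j : (i < 12)%N -> (j < 12)%N -> inj i *m prj j = (i == j)%:R%:M.
Proof. by move=> i12 j12; rewrite block_inj_prj -val_eqE /= !inordK. Qed.

(** The chains of blocks 0-5, 6-9 and 10-11 are cut after the blocks 5 and 9. *)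
Definition large_shift : 'M[k]_(12 * m) :=
  \sum_(i < 11 | (i != 5 :> nat) && (i != 9 :> nat)) prj i *m inj i.+1.
Local Notation Y := large_shift.

Lemma inj_shift i : (i < 12)%N ->
  inj i *m Y = if i \in [:: 5; 9; 11] then 0 else inj i.+1.
Proof.
move=> i12; rewrite mulmx_sumr.
have E (j : 'I_11) : inj i *m (prj j *m inj j.+1) = if i == j :> nat then inj j.+1 else 0.
  rewrite mulmxA inj_prj //; last by have := ltn_ord j; lia.
  by case: eqP => _; rewrite ?mul1mx ?mul0mx ?scalar_mx0 //= raddf0 mul0mx.
under eq_bigr do rewrite E.
have [i11|] := ltnP i 11; last first.
  move=> i11; have -> : i = 11 by lia.
  by rewrite big1 // => j _; case: eqP => // ej; have := ltn_ord j; lia.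
case: ifPn => [|].
  rewrite !inE => /or3P ii; rewrite big1 // => j /andP[j5 j9]; case: eqP => // ej.
  by have := ltn_ord j; case: ii => /eqP ii; lia.
rewrite !inE !negb_or => /and3P[i5 i9 _].
rewrite (bigD1 (Ordinal i11)) /= ?i5 ?i9 // eqxx big1 ?addr0 // => j /andP[_ ji].
by case: eqP => // ej; case/negP: ji; apply/eqP/val_inj.
Qed.

Lemma shift_prj j : (j < 12)%N ->
  Y *m prj j = if j \in [:: 0; 6; 10] then 0 else prj j.-1.
Proof.
move=> j12; rewrite mulmx_suml.
have E (i : 'I_11) : prj i *m inj i.+1 *m prj j = if i.+1 == j then prj i else 0.
  rewrite -mulmxA inj_prj //; last by have := ltn_ord i; lia.
  by case: eqP => _; rewrite ?mulmx1 //= raddf0 mulmx0.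
under eq_bigr do rewrite E.
case: ifPn => [|].
  rewrite !inE => /or3P jj; rewrite big1 // => i /andP[i5 i9]; case: eqP => // ej.
  by have := ltn_ord i; case: jj => /eqP jj; lia.
rewrite !inE !negb_or => /and3P[j0 j6 j10].
have j11 : (j.-1 < 11)%N by lia.
rewrite (bigD1 (Ordinal j11)) /=; last by apply/andP; split; lia.
rewrite prednK ?eqxx; last by lia.
rewrite big1 ?addr0 // => i /andP[_ ij].
by case: eqP => // ej; case/negP: ij; apply/eqP/val_inj; rewrite /= -ej.
Qed.

Lemma large_shift8 : Y ^+ 8 = 0.
Proof.
have injY t : forall i, (i < 12)%N ->
    ((if i < 6 then 6 else if i < 10 then 10 else 12) <= i + t)%N -> inj i *m Y ^+ t = 0.
  elim: t => [|t IH] i i12 it; first by case: ifP it => [|_]; [|case: ifP]; lia.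
  rewrite exprS mulmxA inj_shift //; case: ifPn => [_|]; first by rewrite mul0mx.
  rewrite !inE !negb_or => /and3P[i5 i9 i11]; apply: IH; first by lia.
  by move: it; do 4?case: ifP; lia.
rewrite exprS -[LHS]/(Y *m _) {1}/large_shift mulmx_suml big1 // => i _.
by rewrite -mulmxA injY ?mulmx0 //; have := ltn_ord i; do ?case: ifP; lia.
Qed.

(** The generators of W, named by their orders. *)
Definition gen4 := inj 2 + inj 7 + inj 10.
Definition gen2 := inj 8 + J *m inj 11.
(** The rows are gen4 Y^i for i < 4, followed by gen2 Y^i for i < 2. *)
Definition large_sub :=
  col_mx gen4 (col_mx (inj 3 + inj 8 + inj 11) (col_mx (inj 4 + inj 9)
    (col_mx (inj 5) (col_mx gen2 (inj 9))))).
Local Notation W := large_sub.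

Lemma large_sub_gens : [/\ (gen4 <= W)%MS, ((inj 3 + inj 8 + inj 11)%R <= W)%MS &
  [/\ ((inj 4 + inj 9)%R <= W)%MS, (inj 5 <= W)%MS, (gen2 <= W)%MS & (inj 9 <= W)%MS]].
Proof.
have := submx_refl W; rewrite {1}/large_sub !col_mx_sub.
by case/andP=> ? /andP[? /andP[? /andP[? /andP[? ?]]]]; split; [| |split].
Qed.

Lemma large_sub_shift : stablemx W Y.
Proof.
have [W1 W2 [W3 W4 W5 W6]] := large_sub_gens.
rewrite {1}/large_sub !mul_col_mx !col_mx_sub /gen4 /gen2.
rewrite !mulmxDl -mulmxA !inj_shift //= mulmx0 !addr0.
by rewrite W2 W3 W4 W6 !sub0mx.
Qed.

(** Coordinates of Y^2 s, Y r and q agree on W, and that of Y q is determined by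
    those of Y^3 s and Y^2 r. *)
Lemma large_sub_relations r (C : 'M_(r, 12 * m)) : (C <= W)%MS ->
  [/\ C *m prj 7 = C *m prj 2, C *m prj 10 = C *m prj 2 &
      C *m prj 11 = C *m prj 3 *m (1%:M - J) + C *m prj 8 *m J].
Proof.
move=> /submxP[D ->]; rewrite -!mulmxA !mulmxA -!(mulmxA D).
have WE : [/\ W *m prj 7 = W *m prj 2, W *m prj 10 = W *m prj 2 &
      W *m prj 11 = W *m prj 3 *m (1%:M - J) + W *m prj 8 *m J].
  rewrite /large_sub /gen4 /gen2 !mul_col_mx !mulmxDl -!(mulmxA J) !inj_prj //=.
  have z0 : 0%:M = 0 :> 'M[k]_m by rewrite raddf0.
  by rewrite !z0 !(mul0mx, mulmx0, mul1mx, mulmx1, addr0, add0r, add_col_mx) subrK.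
by case: WE => -> -> ->; rewrite mulmxDr.
Qed.

(** An endomorphism f of Z has diagonal blocks a, b, c on s, r, q.  Applying f to
    the generators of W and comparing with the relations that hold in W gives
    a = b = c from the first one, and then J a = a J from the second one. *)
Lemma large_endo f : Y *m f = f *m Y -> stablemx W f ->
  J *m (inj 0 *m f *m prj 0) = inj 0 *m f *m prj 0 *m J.
Proof.
move=> Yf Wf; pose F i j := inj i *m f *m prj j.
have FS i j : (i < 12)%N -> (j < 12)%N ->
    (if i \in [:: 5; 9; 11] then 0 else F i.+1 j) =
    (if j \in [:: 0; 6; 10] then 0 else F i j.-1).
  move=> i12 j12; transitivity (inj i *m Y *m f *m prj j).
    by rewrite inj_shift //; case: ifP; rewrite ?mul0mx.
  rewrite -(mulmxA _ Y f) Yf mulmxA -(mulmxA _ Y) shift_prj //.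
  by case: ifP; rewrite ?mulmx0.
have F_0_1 : F 1 1 = F 0 0 := FS 0 1 isT isT.
have F_1_2 : F 2 2 = F 1 1 := FS 1 2 isT isT.
have F_6_7 : F 7 7 = F 6 6 := FS 6 7 isT isT.
have F_7_8 : F 8 8 = F 7 7 := FS 7 8 isT isT.
have F_10_11 : F 11 11 = F 10 10 := FS 10 11 isT isT.
have F_9_5 : 0 = F 9 4 := FS 9 5 isT isT.
have F_8_4 : F 9 4 = F 8 3 := FS 8 4 isT isT.
have F_7_3 : F 8 3 = F 7 2 := FS 7 3 isT isT.
have F_11_4 : 0 = F 11 3 := FS 11 4 isT isT.
have F_10_3 : F 11 3 = F 10 2 := FS 10 3 isT isT.
have F_11_9 : 0 = F 11 8 := FS 11 9 isT isT.
have F_10_8 : F 11 8 = F 10 7 := FS 10 8 isT isT.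
have F_0_6 : F 1 6 = 0 := FS 0 6 isT isT.
have F_1_7 : F 2 7 = F 1 6 := FS 1 7 isT isT.
have F_1_10 : F 2 10 = 0 := FS 1 10 isT isT.
have F_6_10 : F 7 10 = 0 := FS 6 10 isT isT.
have F_7_11 : F 8 11 = F 7 10 := FS 7 11 isT isT.
have [W1 _ [_ _ W5 _]] := large_sub_gens.
have [E1 E2 _] := large_sub_relations (submx_trans (submxMr f W1) Wf).
have [_ _ E3] := large_sub_relations (submx_trans (submxMr f W5) Wf).
move: E1 E2 E3; rewrite /gen4 /gen2 !mulmxDl -!(mulmxA J).
rewrite -!/(F 2 _) -!/(F 7 _) -!/(F 10 _) -!/(F 8 _) -!/(F 11 _) -/(F 0 0).
rewrite F_1_7 F_0_6 F_6_7 -F_10_8 -F_11_9 -F_7_3 -F_8_4 -F_9_5 -F_10_3 -F_11_4.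
rewrite F_1_2 F_0_1 F_1_10 F_6_10 F_7_11 F_6_10 F_10_11 F_7_8 F_6_7.
rewrite ?(mul0mx, mulmx0, add0r, addr0) => E1 E2 E3.
by rewrite -{1}E2 E3 E1.
Qed.

End LargeModule.

(** * The cyclic group of order 4 *)

(** The number of terms of the tensor in the separability data bounds the growth of
    ranks under transfer independently of Z.  So J is chosen of size exceeding 6
    times this number, and the identity of the pair attached to J becomes a sum of
    endomorphisms whose blocks commute with J and are not invertible. *)
Theorem order_four_inequivalent (k : fieldType) (gT hT : finGroupType) (n : nat) :
    2 \in [pchar k] -> cyclic [set: gT] -> #|[set: gT]| = 4 ->
    cyclic [set: hT] -> #|[set: hT]| = (2 ^ n)%N -> (2 < n)%N ->
  ~ separably_equivalent (group_algebra k gT) (group_algebra k hT).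
Proof.
move=> char2 /cyclicP[g gcyc] gcard /cyclicP[h hcyc] hcard n_gt2.
case=> M [N] [_] [YB] [_ [fgN _ _ _] _ /retract_data[l [pr sep]]].
pose m := (6 * size l)%N; pose J := shift_mx k m.
pose Y : 'M[k]_(12 * m.+1) := large_shift k m.+1.
have T1 : (Y + 1) ^+ #|[set: hT]| = 1.
  rewrite hcard unipotent_order //.
  by rewrite -(subnKC n_gt2) expnD exprM large_shift8 expr0n expn_eq0.
have [rho [rep _ rhoA rhoh]] := cyclic_row_rep hcyc T1.
have [rho1 rhoM rhoD] := rep.
have rhoy : rho (ga_delta k h + 1) = Y.
  by rewrite rhoD rhoh rho1 -addrA (lmod_char2 char2) addr0.
have [d [Phi [X [P hd]]]] := hom_data_exists fgN sep rep.
have X1 := hom_act1 hd; have XD := hom_actD hd; have XM := hom_actM hd.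
have XA := hom_act_alg hd rhoA.
pose x := ga_delta k g + 1.
have x4 : x ^+ 4 = 0 by exact: (ga_nilpotent char2 (n := 2)).
have Xx4 : X x *m X x *m X x *m X x = 0.
  by have := XA 0; rewrite scale0r raddf0 -x4 !exprS expr0 mulr1 !XM => <-.
have Xg : X (ga_delta k g) = X x + 1%:M.
  by rewrite -X1 -XD -addrA (lmod_char2 char2) addr0.
have rhoh_shift : rho (ga_delta k h) = Y + 1%:M by [].
have Wrho : forall b, stablemx (large_sub J) (rho b).
  apply: (stable_act hcyc rhoM rhoD rho1 rhoA).
  by rewrite rhoh_shift stablemxD ?large_sub_shift ?mulmx1 ?submx_refl.
have [u [U [UX UW]]] := transfer_stable l hd Wrho.
have [s sP s1] := low_rank_decomposition Xx4 (UX x).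
pose ls := [seq inj k m.+1 0 *m sep_transfer l Phi P p *m prj k m.+1 0 | p <- s].
have ls1 : \sum_(a <- ls) a = 1%:M.
  rewrite big_map -mulmx_suml -mulmx_sumr -transfer_sum s1 (transfer1 sep rep hd).
  by rewrite mulmx1 inj_prj.
suff /eqP : \sum_(a <- ls) a != 1%:M by rewrite ls1.
apply: shift_centralizer => _ /mapP[p ps ->]; have [Xp Up p6] := sP p ps; split.
  have p_comm : forall a, X a *m p = p *m X a.
    apply: (comm_act gcyc XM XD X1 XA).
    by rewrite Xg mulmxDl mulmxDr Xp mul1mx mulmx1.
  apply: large_endo; last exact: UW.
  by rewrite -/Y -rhoy (transfer_comm sep rep hd _ p_comm).
apply: leq_trans (leq_trans (mxrankM_maxl _ _) (mxrankM_maxr _ _)) _.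
by apply: leq_trans (rank_transfer _ _ _ _) _; rewrite /m mulnC leq_mul2r p6 orbT.
Qed.

(** * Pairwise inequivalence *)

Local Close Scope ring_scope.

Theorem mainTheorem9 (k : fieldType) (char2 : 2 \in [pchar k]%R)
  (n : nat) (n_gt2 : 2 < n)
  (C2 C4 C2n : finGroupType)
  (C2_cyclic : cyclic [set: C2]) (C2_order : #|[set: C2]| = 2)
  (C4_cyclic : cyclic [set: C4]) (C4_order : #|[set: C4]| = 4)
  (C2n_cyclic : cyclic [set: C2n]) (C2n_order : #|[set: C2n]| = 2 ^ n) :
  [/\ ~ separably_equivalent (group_algebra k C2) (group_algebra k C4),
      ~ separably_equivalent (group_algebra k C2) (group_algebra k C2n) &
      ~ separably_equivalent (group_algebra k C4) (group_algebra k C2n)].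
Proof.
split.
- exact: (@order_two_inequivalent k C2 C4 2).
- apply: (@order_two_inequivalent k C2 C2n n) => //; exact: ltnW.
- exact: (@order_four_inequivalent k C4 C2n n).
Qed.
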